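(* For any centrally symmetric convex body $X\subset\mathbb R^{2n}$ one has $$c_{EHZ}(X)\cdot c_{EHZ}(X^\omega)\le \pi^2.$$ In particular, when $X\subset\mathbb R^{2n}$ is a symplectically self-polar convex body (that is, $X=X^\omega$), then $c_{EHZ}(X)\le\pi$.
   Context: A convex body is a compact convex set with nonempty interior; it is centrally symmetric if $X=-X$. Let $\omega$ be the standard symplectic form on $\mathbb R^{2n}\cong\mathbb C^n$ and $J$ the multiplication by $\sqrt{-1}$, so that $\omega(x,y)=Jx\cdot y$. The symplectic polar of a convex body $X$ with the origin in its interior is $X^\omega=\{y\in\mathbb R^{2n} : \omega(x,y)\le 1\ \forall x\in X\}$; $X$ is symplectically self-polar if it contains the origin in its interior and $X=X^\omega$. The Ekeland--Hofer--Zehnder capacity $c_{EHZ}$ of a convex body $X\subset\mathbb R^{2n}$: if $X$ has smooth boundary and the origin in its interior, with gauge function $g_X$ (so $X=\{g_X\le 1\}$), a closed characteristic is a closed curve $\gamma:[0,T]\to\partial X$, $\gamma(0)=\gamma(T)$, $T>0$, satisfying $\dot\gamma=J\nabla g_X(\gamma)$; its action is $A(\gamma)=\frac12\int_0^T\omega(\gamma,\dot\gamma)\,dt$; and $c_{EHZ}(X)$ is the minimum of $A(\gamma)$ over all closed characteristics. For general convex bodies $c_{EHZ}$ is defined by continuous extension in the Hausdorff metric. *)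

(* Defs.v *)
From HB Require Import structures.
From mathcomp Require Import all_boot all_order all_algebra.
From mathcomp Require Import all_classical all_reals all_analysis.

Set Implicit Arguments.
Unset Strict Implicit.
Unset Printing Implicit Defensive.

Import Order.TTheory GRing.Theory Num.Theory.
Import numFieldNormedType.Exports.

Local Open Scope classical_set_scope.
Local Open Scope ring_scope.

Definition dot (R : realType) (m : nat) (x y : 'rV[R]_m) : R :=
  \sum_i x 0 i * y 0 i.

(* The norm of 'rV[R]_m in the library is the sup norm. *)
Definition enorm (R : realType) (m : nat) (x : 'rV[R]_m) : R :=
  Num.sqrt (dot x x).

Definition gradient (R : realType) (m : nat) (f : 'rV[R]_m -> R)
    (x : 'rV[R]_m) : 'rV[R]_m :=
  \row_i 'D_(delta_mx 0 i) f x.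

(* R^2n = C^n with (q, p) standing for q + i p, hence J (q, p) = (- p, q). *)
Definition J (R : realType) (n : nat) (x : 'rV[R]_(n + n)) : 'rV[R]_(n + n) :=
  row_mx (- rsubmx x) (lsubmx x).

Definition omega (R : realType) (n : nat) (x y : 'rV[R]_(n + n)) : R :=
  dot (J x) y.

Definition convex_body (R : realType) (m : nat) (X : set 'rV[R]_m) : Prop :=
  [/\ compact X, convex_set (X : set (convex_lmodType 'rV[R]_m))
    & interior X !=set0].

Definition centrally_symmetric (R : realType) (m : nat)
    (X : set 'rV[R]_m) : Prop :=
  X = [set - x | x in X].

Definition symplectic_polar (R : realType) (n : nat)
    (X : set 'rV[R]_(n + n)) : set 'rV[R]_(n + n) :=
  [set y | forall x, X x -> omega x y <= 1].

Definition symplectically_self_polar (R : realType) (n : nat)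
    (X : set 'rV[R]_(n + n)) : Prop :=
  interior X 0 /\ X = symplectic_polar X.

Definition boundary (R : realType) (m : nat)
    (X : set 'rV[R]_m) : set 'rV[R]_m :=
  closure X `\` interior X.

(* C^oo on an open set U: every iterated directional derivative is
   differentiable at every point of U. *)
Definition smooth_on (R : realType) (m : nat) (U : set 'rV[R]_m)
    (f : 'rV[R]_m -> R) : Prop :=
  forall (vs : seq 'rV[R]_m) (x : 'rV[R]_m), U x ->
    differentiable (foldr (fun v (g : 'rV[R]_m -> R) => 'D_v g) f vs) x.

(* The boundary is locally a regular level set of a smooth function. *)
Definition smooth_boundary (R : realType) (m : nat)
    (X : set 'rV[R]_m) : Prop :=
  forall p, boundary X p ->
    exists (U : set 'rV[R]_m) (f : 'rV[R]_m -> R),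
      [/\ open U, U p, smooth_on U f, gradient f p <> 0
        & boundary X `&` U = [set x | f x = 0] `&` U].

Definition gauge_fun (R : realType) (m : nat) (X : set 'rV[R]_m)
    (x : 'rV[R]_m) : R :=
  inf [set t : R | 0 < t /\ X (t^-1 *: x)].

(* The equation is imposed on ]0, T[ only; by continuity on [0, T] it then
   holds at both ends for the one-sided derivatives. *)
Definition closed_characteristic (R : realType) (n : nat)
    (X : set 'rV[R]_(n + n)) (T : R) (gamma : R -> 'rV[R]_(n + n)) : Prop :=
  [/\ 0 < T,
      {within `[0, T], continuous gamma},
      gamma 0 = gamma T,
      (forall t, t \in `[0, T] -> boundary X (gamma t))
    & (forall t, t \in `]0, T[ ->
        is_derive t (1 : R) gamma (J (gradient (gauge_fun X) (gamma t))))].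

Definition action (R : realType) (n : nat) (T : R)
    (gamma : R -> 'rV[R]_(n + n)) : R :=
  2^-1 * (\int[lebesgue_measure]_(t in `[0, T])
            omega (gamma t) (derive1 gamma t))%R.

Definition characteristic_actions (R : realType) (n : nat)
    (X : set 'rV[R]_(n + n)) : set R :=
  [set a | exists T gamma,
     closed_characteristic X T gamma /\ a = action T gamma].

(* The minimum of the set of actions, with the default value 0 when there
   is no minimum. *)
Definition min_action (R : realType) (n : nat)
    (X : set 'rV[R]_(n + n)) : R :=
  xget 0 [set a | characteristic_actions X a /\
                  lbound (characteristic_actions X) a].

Definition smooth_body (R : realType) (n : nat)
    (X : set 'rV[R]_(n + n)) : Prop :=
  [/\ convex_body X, smooth_boundary X & interior X 0].

Definition hausdorff_dist (R : realType) (m : nat) (X Y : set 'rV[R]_m) : R :=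
  inf [set e : R | [/\ 0 <= e,
    forall x, X x -> exists2 y, Y y & enorm (x - y) <= e
    & forall y, Y y -> exists2 x, X x & enorm (x - y) <= e]].

Definition hausdorff_nbhs (R : realType) (m : nat) (X : set 'rV[R]_m) :
    set_system (set 'rV[R]_m) :=
  filter_from [set e : R | 0 < e] (fun e => [set Y | hausdorff_dist X Y < e]).

(* The continuous extension in the Hausdorff metric of the minimal action on
   smooth bodies with the origin in their interior.  The limit includes Y = X,
   so on such a body it is the minimal action itself.  It is meant for bodies
   containing the origin, as centrally symmetric ones do; those not containing
   it are not limits of bodies of this kind. *)
Definition c_EHZ (R : realType) (n : nat) (X : set 'rV[R]_(n + n)) : R :=
  lim (min_action Y @[Y --> within (@smooth_body R n) (hausdorff_nbhs X)]).

(* Main.v *)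
Require Import Defs.
From HB Require Import structures.
From mathcomp Require Import all_boot all_order all_algebra.
From mathcomp Require Import all_classical all_reals all_analysis.
From mathcomp Require Import measurable_realfun.
From mathcomp Require Import ring lra zify.

(* Both capacities are bounded through a discretized loop space.  Let [act] be the
   symplectic action of antiperiodic polygons with m edges, a quadratic form on
   (R^2n)^m whose top eigenvalue is also its spectral radius.
   - Spectral duality: on the span W of the top and the negative eigenvectors,
     the inverse form K satisfies K <= act / top^2.  If u maximizes K on W at fixed
     X-norm, the dual vector v of u has the W-component prescribed by K, and [act] is
     nonnegative on the orthogonal of W; this gives
     act(u) act(v) >= top^2 |u|_X^2 |v|_(X^omega)^2.
   - Clarke duality: a maximizer of [act] at fixed X^omega-norm solves the
     trapezoidal scheme of the Hamiltonian flow of g_X^2 / 2 with antiperiodic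
     boundary conditions; as m tends to infinity it converges along an ultrafilter to
     a closed characteristic of X.
   So X and X^omega have closed characteristics with actions P, P' such that
   P P' <= lim (2 m tan (pi / 2m))^2 = pi^2.  The argument is applied to smooth bodies
   {sum_j l_j^(2p) <= 1} approximating X and X^omega from inside. *)

Set Implicit Arguments.
Unset Strict Implicit.
Unset Printing Implicit Defensive.

Import Order.TTheory GRing.Theory Num.Theory.
Import numFieldNormedType.Exports.

Local Open Scope classical_set_scope.
Local Open Scope ring_scope.

(** * Symplectic linear algebra *)

Section SymplecticLinearAlgebra.
Variable R : realType.

(** Why antiperiodic: edges followed by their opposites always close up, so the maximization runs
    over all of [(R^2n)^m]. Closed polygons without this symmetry would carry the constraint that
    the edges sum to zero, hence a Lagrange multiplier, that is, an unknown translation of the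
    orbit; a body symmetric about the origin allows it to be avoided. Origin of the constant: a
    maximizer with quotient [mu] moves by time steps [2 / mu], and [m] steps make the half-period
    [P = 2 m / mu]; a characteristic of period [2 P] has action [P]. The duality bounds [mu mu']
    below by [cot (pi / 2m) ^ 2]. The orbits bound [min_action] from above, which is the direction
    required; the default value 0 of a missing minimum or limit also satisfies the bounds. *)

Lemma dotC m (x y : 'rV[R]_m) : dot x y = dot y x.
Proof. by apply: eq_bigr => i _; rewrite mulrC. Qed.

Lemma dotDl m (x y z : 'rV[R]_m) : dot (x + y) z = dot x z + dot y z.
Proof. by rewrite -big_split; apply: eq_bigr => i _; rewrite mxE mulrDl. Qed.

Lemma dotZl m c (x y : 'rV[R]_m) : dot (c *: x) y = c * dot x y.
Proof. by rewrite mulr_sumr; apply: eq_bigr => i _; rewrite mxE mulrA. Qed.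

Lemma dotDr m (x y z : 'rV[R]_m) : dot x (y + z) = dot x y + dot x z.
Proof. by rewrite dotC dotDl !(dotC x). Qed.

Lemma dotZr m c (x y : 'rV[R]_m) : dot x (c *: y) = c * dot x y.
Proof. by rewrite dotC dotZl dotC. Qed.

Lemma dotNl m (x y : 'rV[R]_m) : dot (- x) y = - dot x y.
Proof. by rewrite -scaleN1r dotZl mulN1r. Qed.

Lemma dotNr m (x y : 'rV[R]_m) : dot x (- y) = - dot x y.
Proof. by rewrite dotC dotNl dotC. Qed.

Lemma dot0l m (x : 'rV[R]_m) : dot 0 x = 0.
Proof. by rewrite -(scale0r 0) dotZl mul0r. Qed.

Lemma dot0r m (x : 'rV[R]_m) : dot x 0 = 0.
Proof. by rewrite dotC dot0l. Qed.

Lemma dot_suml m (I : Type) (r : seq I) (P : pred I) (F : I -> 'rV[R]_m) y :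
  dot (\sum_(i <- r | P i) F i) y = \sum_(i <- r | P i) dot (F i) y.
Proof. by elim/big_rec2: _ => [|i u v _ <-]; rewrite ?dot0l ?dotDl. Qed.

Lemma dot_sumr m (I : Type) (r : seq I) (P : pred I) (F : I -> 'rV[R]_m) y :
  dot y (\sum_(i <- r | P i) F i) = \sum_(i <- r | P i) dot y (F i).
Proof. by rewrite dotC dot_suml; apply: eq_bigr => i _; rewrite dotC. Qed.

Lemma dot_ge0 m (x : 'rV[R]_m) : 0 <= dot x x.
Proof. by apply: sumr_ge0 => i _; rewrite -expr2 sqr_ge0. Qed.

Lemma dot_eq0 m (x : 'rV[R]_m) : dot x x = 0 -> x = 0.
Proof.
move=> /eqP; rewrite psumr_eq0 => [/allP x0|i _]; last by rewrite -expr2 sqr_ge0.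
apply/rowP => i; rewrite mxE; apply/eqP.
by have := x0 i (mem_index_enum _); rewrite /= mulf_eq0 orbb.
Qed.

Lemma dot_gt0 m (x : 'rV[R]_m) : x != 0 -> 0 < dot x x.
Proof.
move=> x0; rewrite lt_neqAle dot_ge0 andbT; apply: contra x0 => /eqP x0.
exact/eqP/dot_eq0.
Qed.

Lemma dot_delta m (i : 'I_m) (x : 'rV[R]_m) : dot (delta_mx 0 i) x = x 0 i.
Proof.
rewrite /dot (bigD1 i) //= mxE !eqxx mul1r big1 ?addr0 // => j ji.
by rewrite mxE eqxx (negbTE ji) mul0r.
Qed.

Lemma dot_ext m (x y : 'rV[R]_m) : (forall a, dot a x = dot a y) -> x = y.
Proof. by move=> xy; apply/rowP => i; rewrite -!dot_delta. Qed.

Variable n : nat.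
Implicit Types x y z : 'rV[R]_(n + n).

Lemma J_row_mx (a b : 'rV[R]_n) : J (row_mx a b) = row_mx (- b) a.
Proof. by rewrite /J row_mxKr row_mxKl. Qed.

Lemma dot_row_mx (a b c d : 'rV[R]_n) :
  dot (row_mx a b) (row_mx c d) = dot a c + dot b d.
Proof.
rewrite /dot big_split_ord /=; congr (_ + _); apply: eq_bigr => i _.
  by rewrite !row_mxEl.
by rewrite !row_mxEr.
Qed.

Lemma JD x y : J (x + y) = J x + J y.
Proof. by rewrite /J !linearD /= add_row_mx. Qed.

Lemma JZ c x : J (c *: x) = c *: J x.
Proof. by rewrite /J !linearZ /= scale_row_mx scalerN. Qed.

Lemma JN x : J (- x) = - J x.
Proof. by rewrite -scaleN1r JZ scaleN1r. Qed.

Lemma J0 : J (0 : 'rV[R]_(n + n)) = 0.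
Proof. by have := JZ 0 0; rewrite !scale0r. Qed.

Lemma JJ x : J (J x) = - x.
Proof. by rewrite /J row_mxKr row_mxKl -opp_row_mx hsubmxK. Qed.

Lemma dotJJ x y : dot (J x) (J y) = dot x y.
Proof.
rewrite -(hsubmxK x) -(hsubmxK y) !J_row_mx !dot_row_mx dotNl dotNr opprK.
by rewrite addrC.
Qed.

Lemma dotJ x y : dot x (J y) = - dot (J x) y.
Proof. by rewrite -[in RHS](dotJJ (J x)) JJ dotNl opprK. Qed.

Lemma omegaE x y : omega x y = dot (J x) y.
Proof. by []. Qed.

Lemma omegaC x y : omega x y = - omega y x.
Proof. by rewrite /omega -dotJ dotC. Qed.

Lemma omegaxx x : omega x x = 0.
Proof. by have := omegaC x x; lra. Qed.

Lemma omegaDl x y z : omega (x + y) z = omega x z + omega y z.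
Proof. by rewrite /omega JD dotDl. Qed.

Lemma omegaDr x y z : omega x (y + z) = omega x y + omega x z.
Proof. exact: dotDr. Qed.

Lemma omegaZl c x y : omega (c *: x) y = c * omega x y.
Proof. by rewrite /omega JZ dotZl. Qed.

Lemma omegaZr c x y : omega x (c *: y) = c * omega x y.
Proof. exact: dotZr. Qed.

Lemma omegaNl x y : omega (- x) y = - omega x y.
Proof. by rewrite -scaleN1r omegaZl mulN1r. Qed.

Lemma omegaNr x y : omega x (- y) = - omega x y.
Proof. exact: dotNr. Qed.

Lemma omega0l y : omega 0 y = 0.
Proof. by rewrite /omega J0 dot0l. Qed.

Lemma omega0r x : omega x 0 = 0.
Proof. exact: dot0r. Qed.

Lemma omega_suml (I : Type) (r : seq I) (P : pred I)
    (F : I -> 'rV[R]_(n + n)) y :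
  omega (\sum_(i <- r | P i) F i) y = \sum_(i <- r | P i) omega (F i) y.
Proof. by elim/big_rec2: _ => [|i u v _ <-]; rewrite ?omega0l ?omegaDl. Qed.

Lemma omega_ext x y : (forall a, omega a x = omega a y) -> x = y.
Proof.
move=> xy; apply: dot_ext => a.
by have := xy (- J a); rewrite /omega JN JJ opprK.
Qed.

(** Multiplication by [exp (i th)] on [C^n]. *)
Definition rot (th : R) x : 'rV[R]_(n + n) := cos th *: x + sin th *: J x.

Lemma rotD th x y : rot th (x + y) = rot th x + rot th y.
Proof. by rewrite /rot JD !scalerDr addrACA. Qed.

Lemma rotZ th c x : rot th (c *: x) = c *: rot th x.
Proof. by rewrite /rot JZ scalerDr !scalerA ![_ * c]mulrC. Qed.

Lemma rot_0 th : rot th 0 = 0.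
Proof. by have := rotZ th 0 0; rewrite !scale0r. Qed.

Lemma rot_sum th (I : Type) (r : seq I) (P : pred I)
    (F : I -> 'rV[R]_(n + n)) :
  rot th (\sum_(i <- r | P i) F i) = \sum_(i <- r | P i) rot th (F i).
Proof. by elim/big_rec2: _ => [|i u v _ <-]; rewrite ?rot_0 ?rotD. Qed.

Lemma J_rot th x : J (rot th x) = rot th (J x).
Proof. by rewrite /rot JD !JZ. Qed.

Lemma rot_rot a b x : rot a (rot b x) = rot (a + b) x.
Proof.
rewrite /rot JD !JZ JJ cosD sinD; move: (J x) => y.
by apply/rowP => i; rewrite !mxE; ring.
Qed.

Lemma dot_rot a x y : dot (rot a x) y = dot x (rot (- a) y).
Proof. by rewrite /rot cosN sinN dotDl dotDr !dotZl !dotZr dotJ mulrNN. Qed.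

Lemma omega_rot a x y : omega (rot a x) y = omega x (rot (- a) y).
Proof. by rewrite /omega J_rot dot_rot. Qed.

End SymplecticLinearAlgebra.

(** * The spectrum of the discrete action *)

Section DiscreteFourier.
Variables (R : realType) (m : nat).

(** The numbers [exp (i theta_k)] for [k < m] are the [m]-th roots of -1, that is, the frequencies
    of antiperiodic sequences. The eigenvalues of [act] are the cotangents [ct k] of the
    half-angles. *)
Definition theta (k : nat) : R := pi * (k.*2.+1)%:R / m%:R.

Definition ct (k : nat) : R := cos (theta k / 2) / sin (theta k / 2).

Lemma cos_add_2pi_nat (x : R) (d : nat) : cos (x + 2 * pi * d%:R) = cos x.
Proof.
elim: d => [|d IH]; first by rewrite mulr0 addr0.
rewrite -[RHS]IH -[RHS]cosD2pi; congr cos; rewrite -[d.+1%:R]natr1; ring.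
Qed.

Lemma sin_add_2pi_nat (x : R) (d : nat) : sin (x + 2 * pi * d%:R) = sin x.
Proof. by rewrite -!cosBpihalf addrAC cos_add_2pi_nat. Qed.

Hypothesis m_gt0 : (0 < m)%N.

Let mR : (m%:R : R) != 0. Proof. by rewrite pnatr_eq0 -lt0n. Qed.

(** Multiplication by [2 sin (pi d / m)], which is nonzero for [0 < d < m], makes the sum telescope,
    and its two ends differ by [d] full turns. *)
Lemma sum_cos_arith (a : R) (d : nat) : (0 < d < m)%N ->
  \sum_(k < m) cos (a + 2 * pi * d%:R * k%:R / m%:R) = 0.
Proof.
move=> /andP[d0 dm]; set h : R := pi * d%:R / m%:R.
have sh : 0 < sin h.
  have mp : 0 < (m%:R : R) by rewrite ltr0n.
  apply: sin_gt0_pi; apply/andP; split.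
    by rewrite divr_gt0 ?mulr_gt0 ?pi_gt0 ?ltr0n.
  by rewrite ltr_pdivrMr // ltr_pM2l ?pi_gt0 // ltr_nat.
apply: (mulfI (lt0r_neq0 sh)); apply: (@mulfI _ 2) => //; rewrite !mulr0 !mulr_sumr.
pose f (k : nat) : R := sin (a - h + 2 * h * k%:R).
have E k : 2 * (sin h * cos (a + 2 * pi * d%:R * k%:R / m%:R)) = f k.+1 - f k.
  rewrite /f -[k.+1%:R]natr1.
  have -> : a - h + 2 * h * (k%:R + 1) = (a + 2 * h * k%:R) + h by ring.
  have -> : a - h + 2 * h * k%:R = (a + 2 * h * k%:R) - h by ring.
  rewrite sinD sinB; set b := a + 2 * h * k%:R.
  have -> : a + 2 * pi * d%:R * k%:R / m%:R = b by rewrite /b /h; ring.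
  ring.
rewrite (eq_bigr (fun k : 'I_m => f k.+1 - f k)) => [|k _]; last exact: E.
rewrite -(big_mkord xpredT (fun k => f k.+1 - f k)) telescope_sumr // /f.
have -> : 2 * h * m%:R = 2 * pi * d%:R by rewrite /h; field.
by rewrite sin_add_2pi_nat mulr0 addr0 subrr.
Qed.

Lemma sum_sin_arith (a : R) (d : nat) : (0 < d < m)%N ->
  \sum_(k < m) sin (a + 2 * pi * d%:R * k%:R / m%:R) = 0.
Proof.
move=> dm; apply: etrans (sum_cos_arith (a - pi / 2) dm); apply: eq_bigr => k _.
by rewrite -cosBpihalf addrAC.
Qed.

Lemma theta_half_itv (k : nat) : (k < m)%N -> 0 < theta k / 2 < pi.
Proof.
move=> km; have mp : 0 < (m%:R : R) by rewrite ltr0n.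
rewrite /theta !divr_gt0 ?mulr_gt0 ?pi_gt0 ?ltr0n //=.
rewrite ltr_pdivrMr // ltr_pdivrMr // -mulrA ltr_pM2l ?pi_gt0 //.
by rewrite -natrM ltr_nat; lia.
Qed.

Lemma sin_theta_gt0 (k : nat) : (k < m)%N -> 0 < sin (theta k / 2).
Proof. by move=> km; apply: sin_gt0_pi; exact: theta_half_itv. Qed.

Lemma sum_cos_theta (d : nat) : (0 < d < m)%N ->
  \sum_(k < m) cos (theta k * d%:R) = 0.
Proof.
move=> dm; apply: etrans (sum_cos_arith (pi * d%:R / m%:R) dm).
apply: eq_bigr => k _; congr cos; rewrite /theta -[k.*2.+1%:R]natr1 -muln2 natrM; ring.
Qed.

(** The reflection of [k] into [m - 1 - k] sends [theta] to [2 pi - theta]: it reverses the sign of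
    the cotangent and keeps the cosine, so the sum equals its opposite. *)
Lemma sum_ct_cos (d : nat) : \sum_(k < m) ct k * cos (theta k * d%:R) = 0.
Proof.
set S := LHS.
suff : S = - S by move=> SS; lra.
rewrite {1}/S (reindex_inj rev_ord_inj) /= -sumrN; apply: eq_bigr => k _.
have E : theta (m - k.+1) = 2 * pi - theta k.
  rewrite /theta -!natr1 -!muln2 !natrM natrB // -natr1; field.
  exact: mR.
rewrite /ct E.
have -> : (2 * pi - theta k) / 2 = - (theta k / 2) + pi by field.
rewrite cosDpi sinDpi cosN sinN.
have -> : (2 * pi - theta k) * d%:R = - (theta k * d%:R) + 2 * pi * d%:R by ring.
rewrite cos_add_2pi_nat cosN opprK.
by rewrite !mulNr.
Qed.

(* The discrete Dirichlet kernel: the difference in [d] of the left-hand side is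
   [sum_k (cos (theta_k (d + 1)) + cos (theta_k d))]. *)
Lemma sum_ct_sin (d : nat) : (0 < d < m)%N ->
  \sum_(k < m) ct k * sin (theta k * d%:R) = m%:R.
Proof.
elim: d => // d IH /andP[_ dm].
have E (k : 'I_m) : ct k * sin (theta k * d.+1%:R) =
    ct k * sin (theta k * d%:R)
    + (cos (theta k * d.+1%:R) + cos (theta k * d%:R)).
  set s := sin (theta k / 2); have s0 : s != 0 by apply/lt0r_neq0/sin_theta_gt0.
  pose b := theta k * d%:R + theta k / 2.
  have -> : theta k * d.+1%:R = b + theta k / 2 by rewrite /b -[d.+1%:R]natr1; field.
  have -> : theta k * d%:R = b - theta k / 2 by rewrite /b; field.
  clearbody b; rewrite sinD sinB cosD cosB /ct -/s; field.
  exact: s0.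
rewrite (eq_bigr _ (fun k _ => E k)) !big_split /= sum_cos_theta //.
case: d IH dm {E} => [_ _|d IH dm].
  rewrite big1 => [|k _]; last by rewrite mulr0 sin0 mulr0.
  rewrite !add0r (eq_bigr (fun=> 1)) => [|k _]; last by rewrite mulr0 cos0.
  by rewrite sumr_const card_ord.
by rewrite IH ?sum_cos_theta ?addr0 //; lia.
Qed.

(** The term [0 +] matches the shape of [sum_cos_arith] and [sum_sin_arith] at [a = 0]. *)
Lemma theta_diffE (k l j : nat) : (l <= k)%N ->
  (theta k - theta l) * j%:R = 0 + 2 * pi * (k - l)%:R * j%:R / m%:R.
Proof.
move=> lk; rewrite /theta -!natr1 -!muln2 !natrM natrB //; ring.
Qed.

Lemma sum_cos_orth (k l : 'I_m) : k != l ->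
  \sum_(j < m) cos ((theta k - theta l) * j%:R) = 0.
Proof.
wlog lk : k l / (l < k)%N => [H kl|_].
  case: (ltngtP l k) kl => [lk kl|kl' kl|/val_inj -> /eqP//]; first exact: H.
  apply: etrans (H l k _ _) => //; rewrite 1?eq_sym //; apply: eq_bigr => j _.
  by rewrite -cosN -mulNr opprB.
have dm : (0 < k - l < m)%N by have := ltn_ord k; lia.
apply: etrans (sum_cos_arith 0 dm); apply: eq_bigr => j _.
by rewrite theta_diffE // ltnW.
Qed.

Lemma sum_sin_orth (k l : 'I_m) :
  \sum_(j < m) sin ((theta k - theta l) * j%:R) = 0.
Proof.
have [->|] := eqVneq k l.
  by rewrite big1 // => j _; rewrite subrr mul0r sin0.
wlog lk : k l / (l < k)%N => [H kl|_].
  case: (ltngtP l k) kl => [lk kl|kl' kl|/val_inj -> /eqP//]; first exact: H.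
  apply: oppr_inj; rewrite oppr0 -sumrN.
  apply: etrans (H l k _ _) => //; rewrite 1?eq_sym //.
  by apply: eq_bigr => j _; rewrite -sinN -mulNr opprB.
have dm : (0 < k - l < m)%N by have := ltn_ord k; lia.
apply: etrans (sum_sin_arith 0 dm); apply: eq_bigr => j _.
by rewrite theta_diffE // ltnW.
Qed.

Variable n : nat.
Implicit Types u : 'I_m -> 'rV[R]_(n + n).

(** The sign of [i - j]. For the centred antiperiodic polygon with edges [u], the sum over [j] of
    [sg i j *: u j] is twice the midpoint of the [i]-th edge. *)
Definition sg (i j : 'I_m) : R := (j < i)%N%:R - (i < j)%N%:R.

(* Up to a factor, the symplectic action of the polygon with edges
   [u_0, .., u_(m-1), - u_0, .., - u_(m-1)]. *)
Definition act u : R := \sum_i \sum_j sg i j * omega (u j) (u i).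

Definition fourier (k : nat) u : 'rV[R]_(n + n) :=
  \sum_(l < m) rot (- (theta k * l%:R)) (u l).

(** The Fourier sums of the [ct k] rebuild the kernel: [sum_ct_cos] kills the terms in [dot], and
    [sum_ct_sin] produces [sg] in front of [omega]. The factor [m] comes from the unnormalized
    transform. *)
Lemma act_fourier u :
  m%:R * act u = \sum_(k < m) ct k * dot (fourier k u) (fourier k u).
Proof.
have E (k : 'I_m) : ct k * dot (fourier k u) (fourier k u) =
  \sum_(i < m) \sum_(j < m) (ct k * cos (theta k * (j%:R - i%:R)) * dot (u j) (u i)
                 - ct k * sin (theta k * (j%:R - i%:R)) * omega (u j) (u i)).
  rewrite /fourier dot_sumr mulr_sumr; apply: eq_bigr => i _.
  rewrite dot_suml mulr_sumr; apply: eq_bigr => j _.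
  rewrite dot_rot rot_rot opprK -mulrBr /rot dotDr !dotZr dotJ -omegaE; ring.
rewrite (eq_bigr _ (fun k _ => E k)) exchange_big /= mulr_sumr.
apply: eq_bigr => i _; rewrite exchange_big mulr_sumr; apply: eq_bigr => j _.
rewrite /= sumrB -!mulr_suml mulrA.
rewrite [X in _ = X * _ - _](_ : _ = 0) ?mul0r ?sub0r; last first.
  have [ij|/ltnW ji] := leqP i j.
    by apply: etrans (sum_ct_cos (j - i)); apply: eq_bigr => k _; rewrite natrB.
  apply: etrans (sum_ct_cos (i - j)); apply: eq_bigr => k _.
  by rewrite -cosN -mulrN opprB natrB.
rewrite -mulNr; congr (_ * _); rewrite /sg; case: ltngtP => [ji|ij|/val_inj ->].
- rewrite subr0 mulr1 -(@sum_ct_sin (i - j)); last by have := ltn_ord i; lia.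
  rewrite -sumrN; apply: eq_bigr => k _.
  by rewrite -mulrN -sinN -mulrN opprB natrB // ltnW.
- rewrite sub0r mulrN1 -(@sum_ct_sin (j - i)); last by have := ltn_ord j; lia.
  by congr (- _); apply: eq_bigr => k _; rewrite natrB // ltnW.
- rewrite subrr mulr0 big1 ?oppr0 // => k _.
  by rewrite subrr mulr0 sin0 mulr0.
Qed.

(** The inverse transform restricted to the frequencies in [I], without the factor [1 / m]. *)
Definition synth (I : pred 'I_m) (z : 'I_m -> 'rV[R]_(n + n)) (j : 'I_m) :
  'rV[R]_(n + n) := \sum_(k | I k) rot (theta k * j%:R) (z k).

Lemma fourier_synth (I : pred 'I_m) z (l : 'I_m) :
  fourier l (synth I z) = if I l then m%:R *: z l else 0.
Proof.
have E (k : 'I_m) (x : 'rV[R]_(n + n)) :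
  \sum_(j < m) rot (- (theta l * j%:R)) (rot (theta k * j%:R) x)
    = if k == l then m%:R *: x else 0.
  under eq_bigr => j _ do rewrite rot_rot addrC -mulrBl /rot.
  rewrite big_split /= -!scaler_suml sum_sin_orth scale0r addr0.
  have [->|kl] := eqVneq k l; last by rewrite sum_cos_orth // scale0r.
  under eq_bigr => j _ do rewrite subrr mul0r cos0.
  by rewrite sumr_const card_ord.
rewrite /fourier /synth; under eq_bigr => j _ do rewrite rot_sum.
rewrite exchange_big /= (eq_bigr _ (fun k _ => E k (z k))) -big_mkcondr /=.
case: ifP => Il.
  rewrite (big_pred1 l) // => k /=; case: (eqVneq k l) => [->|_].
    by rewrite Il.
  by rewrite andbF.
by rewrite big_pred0 // => k; case: (eqVneq k l) => [->|_]; rewrite ?Il ?andbF.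
Qed.

(** All half-angles lie in [[theta 0 / 2, pi - theta 0 / 2]], an interval symmetric about [pi / 2];
    the absolute cosine is largest and the sine smallest at its ends. *)
Lemma ct_bound (k : 'I_m) : `|ct k| <= ct 0.
Proof.
have Hk := theta_half_itv (ltn_ord k); have H0 := theta_half_itv m_gt0.
have mp : 0 < (m%:R : R) by rewrite ltr0n.
have p0 := pi_gt0 R.
have lek : theta 0 / 2 <= theta k / 2.
  rewrite ler_pM2r ?invr_gt0 // ler_pM2r ?invr_gt0 // ler_pM2l //.
  by rewrite ler_nat.
have gek : theta k / 2 <= pi - theta 0 / 2.
  rewrite -(ler_pM2r (_ : 0 < 2 * m%:R)) ?mulr_gt0 //.
  have -> : theta k / 2 * (2 * m%:R) = pi * k.*2.+1%:R.
    by rewrite /theta; field.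
  have -> : (pi - theta 0 / 2) * (2 * m%:R) = pi * (m.*2%:R - 1).
    by rewrite /theta double0 -[in RHS]mul2n natrM; field.
  rewrite ler_pM2l // lerBrDr natr1 ler_nat.
  by have := ltn_ord k; lia.
have itv x : 0 < x < pi -> x \in `[0, (pi : R)]%R.
  by move=> /andP[x0 x1]; rewrite in_itv /= !ltW.
have Hr : 0 < pi - theta 0 / 2 < (pi : R) by move: H0 => /andP[? ?]; lra.
have c1 : cos (theta k / 2) <= cos (theta 0 / 2).
  have := lek; rewrite !le_eqVlt => /orP[/eqP ->|]; first by rewrite eqxx.
  by rewrite -ltr_cos ?itv // => ->; rewrite orbT.
have c2 : - cos (theta 0 / 2) <= cos (theta k / 2).
  have -> : - cos (theta 0 / 2) = cos (pi - theta 0 / 2) :> R.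
    by rewrite addrC cosDpi cosN.
  have := gek; rewrite !le_eqVlt => /orP[/eqP ->|]; first by rewrite eqxx.
  by rewrite -ltr_cos ?itv // => ->; rewrite orbT.
have sk := sin_gt0_pi Hk; have s0 := sin_gt0_pi H0.
have le1 : `|cos (theta k / 2)| <= cos (theta 0 / 2) by rewrite ler_norml c2 c1.
have le2 : sin (theta 0 / 2) <= sin (theta k / 2).
  rewrite -(ler_pXn2r (_ : (0 < 2)%N)) ?nnegrE ?(ltW sk) ?(ltW s0) //.
  have := cos2Dsin2 (theta 0 / 2); have := cos2Dsin2 (theta k / 2).
  have : cos (theta k / 2) ^+ 2 <= cos (theta 0 / 2) ^+ 2.
    by rewrite -real_normK ?num_real // lerXn2r ?nnegrE // (le_trans _ le1).
  lra.
rewrite /ct normrM normfV (gtr0_norm sk) ler_pM ?invr_ge0 ?(ltW sk) //.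
by rewrite lef_pV2.
Qed.

Lemma ct0_gt0 : (1 < m)%N -> 0 < ct 0.
Proof.
move=> m1; have /andP[t0 t1] := theta_half_itv m_gt0.
rewrite divr_gt0 ?sin_theta_gt0 //; apply: cos_gt0_pihalf.
have mp : 0 < (m%:R : R) by rewrite ltr0n.
rewrite (lt_trans _ t0) ?oppr_lt0 ?divr_gt0 ?pi_gt0 //= /theta.
rewrite double0 mulr1 ltr_pM2r ?invr_gt0 // gtr_pMr ?pi_gt0 //.
by rewrite invf_lt1 // ltr1n.
Qed.

End DiscreteFourier.

(** * Rayleigh quotients *)

Lemma entry_le_norm (R : realType) (a b : nat) (z : 'M[R]_(a, b)) i j :
  `|z i j| <= `|z|.
Proof.
rewrite -[leRHS]/(mx_norm z) mx_normrE.
by apply/bigmax_geP; right; exists (i, j) => //=.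
Qed.

Lemma vec_mx_continuous (R : realType) (a b : nat) :
  continuous (@vec_mx R a b).
Proof.
move=> v A /nbhs_ballP[e e0 eA]; apply: (filterS _ (nbhsx_ballx v e e0)).
by move=> w [_ vw]; apply: eA; split => // i j; rewrite !mxE; exact: vw.
Qed.

(** Heine-Borel, transported from row vectors along [vec_mx]. *)
Lemma mx_bounded_closed_compact (R : realType) (a b : nat)
    (A : set 'M[R]_(a, b)) (M : R) :
  (forall z, A z -> `|z| <= M) -> closed A -> compact A.
Proof.
move=> AM Acl.
pose K := [set v : 'rV[R]_(a * b) | forall i, `[- M, M]%classic (v ord0 i)].
have Kc : compact K.
  by apply: (@rV_compact _ _ (fun=> `[- M, M]%classic)) => _; exact: segment_compact.
have cK : compact (vec_mx @` K : set 'M[R]_(a, b)).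
  apply: continuous_compact => //.
  by apply: continuous_subspaceT => v; exact: vec_mx_continuous.
apply: (subclosed_compact Acl cK) => z Az; exists (mxvec z); last exact: mxvecK.
move=> i; case/mxvec_indexP: i => i j; rewrite mxvecE /= in_itv /= -ler_norml.
exact: le_trans (entry_le_norm z i j) (AM z Az).
Qed.

Lemma entry_continuous (R : realType) (a b : nat) i j :
  continuous (fun z : 'M[R]_(a, b) => z i j).
Proof. by move=> z; exact/differentiable_continuous/differentiable_coord. Qed.

(** Both functions are homogeneous of degree 2, so [f / Phi] on the cone [C] is already seen on its
    compact unit sphere. The conclusion is cross-multiplied so that it covers [w = 0]; [z0] makes
    the sphere nonempty. *)
Lemma ratio_max (R : realType) (a b : nat) (C : set 'M[R]_(a, b))
    (f Phi : 'M[R]_(a, b) -> R) (z0 : 'M[R]_(a, b)) :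
  closed C -> (forall t z, C z -> C (t *: z)) ->
  continuous f -> continuous Phi ->
  (forall t z, f (t *: z) = t ^+ 2 * f z) ->
  (forall t z, Phi (t *: z) = t ^+ 2 * Phi z) ->
  (forall z, C z -> z != 0 -> 0 < Phi z) ->
  C z0 -> z0 != 0 ->
  exists z, [/\ C z, z != 0 & forall w, C w -> f w * Phi z <= f z * Phi w].
Proof.
move=> Ccl Cs fc Pc fh Ph Pp Cz0 z00.
pose S := C `&` [set z | `|z| = 1].
have Sn0 z : S z -> z != 0.
  by move=> [_ /= z1]; rewrite -normr_eq0 z1 oner_neq0.
have unitS z : C z -> z != 0 -> S (`|z|^-1 *: z).
  move=> Cz z_neq0; split; first exact: Cs.
  by rewrite /= normrZ normfV normr_id mulVf ?normr_eq0.
have Sc : compact S.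
  apply: (@mx_bounded_closed_compact _ _ _ _ 1) => [z [_ /= ->] //|].
  apply: closedI => //.
  apply: (@closed_comp _ _ (fun z : 'M[R]_(a, b) => `|z|) [set 1]).
    by move=> z _; exact: norm_continuous.
  exact: closed_eq.
have S_neq0 : S !=set0 by exists (`|z0|^-1 *: z0); exact: unitS.
have fPc : {within S, continuous (fun z => f z / Phi z)}.
  apply: continuous_in_subspaceT => z; rewrite inE => Sz.
  apply: (@continuousM R _ f (fun z => (Phi z)^-1)); first exact: fc.
  apply: (@continuousV R _ Phi); last exact: Pc.
  by rewrite gt_eqF // Pp //; [case: Sz | exact: Sn0].
have [z zS zmax] := compact_EVT_max S_neq0 Sc fPc.
rewrite inE in zS; exists z; split; [by case: zS | exact: Sn0 |].
have Pz : 0 < Phi z by apply: Pp; [case: zS | exact: Sn0].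
move=> w Cw; have [->|w0] := eqVneq w 0.
  by have := fh 0 0; have := Ph 0 0; rewrite scale0r expr0n !mul0r => -> ->; rewrite mulr0 mul0r.
have Pw := Pp _ Cw w0.
have := zmax (`|w|^-1 *: w); rewrite inE => /(_ (unitS _ Cw w0)).
have nw : 0 < `|w|^-1 ^+ 2 by rewrite exprn_gt0 // invr_gt0 normr_gt0.
rewrite fh Ph invfM mulrACA divff ?lt0r_neq0 // mul1r.
by rewrite ler_pdivrMr // mulrAC ler_pdivlMr.
Qed.

(** * Spectral duality *)

Section Continuity.
Variables (R : realType) (T : topologicalType).

Lemma continuous_add (V : normedModType R) (F G : T -> V) :
  continuous F -> continuous G -> continuous (fun x => F x + G x).
Proof. by move=> Fc Gc x; apply: (@continuousD R V T F G); [exact: Fc|exact: Gc]. Qed.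

Lemma continuous_scale (V : normedModType R) k (F : T -> V) :
  continuous F -> continuous (fun x => k *: F x).
Proof. by move=> Fc x; apply: (@continuousZl_tmp R V T F k); exact: Fc. Qed.

Lemma continuous_mul (F G : T -> R) :
  continuous F -> continuous G -> continuous (fun x => F x * G x).
Proof. by move=> Fc Gc x; apply: (@continuousM R T F G); [exact: Fc|exact: Gc]. Qed.

Lemma continuous_sum (V : normedModType R) (I : Type) (r : seq I) (P : pred I)
    (F : I -> T -> V) :
  (forall i, P i -> continuous (F i)) ->
  continuous (fun x => \sum_(i <- r | P i) F i x).
Proof.
move=> Fc; elim: r => [|i r IH] x.
  rewrite (_ : (fun _ => _) = cst 0); first exact: cst_continuous.
  by apply: funext => y; rewrite big_nil.
have [Pi|nPi] := boolP (P i).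
  rewrite (_ : (fun _ => _) = F i \+ (fun y => \sum_(j <- r | P j) F j y)).
    by apply: continuousD; [exact: Fc | exact: IH].
  by apply: funext => y; rewrite big_cons Pi.
rewrite (_ : (fun _ => _) = (fun y => \sum_(j <- r | P j) F j y)); first exact: IH.
by apply: funext => y; rewrite big_cons (negbTE nPi).
Qed.

Lemma continuous_mx (a b : nat) (F : T -> 'M[R]_(a, b)) :
  (forall i j, continuous (fun x => F x i j)) -> continuous F.
Proof.
move=> Fc x A /nbhs_ballP[e e0 eA].
have : \forall y \near x, forall i j, ball (F x i j) e (F y i j).
  apply: filter_forall => i; apply: filter_forall => j.
  have := Fc i j x; move/cvg_ballP; exact.
by apply: filterS => y Hy; apply: eA; split.
Qed.

Lemma continuous_entry (a b : nat) (F : T -> 'M[R]_(a, b)) i j :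
  continuous F -> continuous (fun x => F x i j).
Proof.
move=> Fc x; apply: (@continuous_comp _ _ _ F (fun z => z i j)).
  exact: Fc.
exact: entry_continuous.
Qed.

Lemma continuous_dot (m : nat) (F G : T -> 'rV[R]_m) :
  continuous F -> continuous G -> continuous (fun x => dot (F x) (G x)).
Proof.
move=> Fc Gc; apply: continuous_sum => i _.
by apply: continuous_mul; apply: continuous_entry.
Qed.

Lemma continuous_dominated_at (F D : T -> R) (x : T) :
  {for x, continuous D} -> D x = 0 ->
  (forall y, `|F x - F y| <= D y) -> {for x, continuous F}.
Proof.
move=> Dc D0 FD; apply/cvgrPdist_lt => e e0.
have : D y @[y --> x] --> D x by exact: Dc.
rewrite D0 => /cvgrPdist_lt/(_ e e0); apply: filterS => y; rewrite sub0r normrN => H.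
by rewrite (le_lt_trans (FD _)) // (le_lt_trans (ler_norm _)).
Qed.

Lemma continuous_dominated (F : T -> R) (D : T -> T -> R) :
  (forall x, continuous (D x)) -> (forall x, D x x = 0) ->
  (forall x y, `|F x - F y| <= D x y) -> continuous F.
Proof. by move=> Dc D0 FD x; apply: (@continuous_dominated_at _ (D x)) => //; exact: Dc. Qed.

Variable n : nat.
Implicit Types F G : T -> 'rV[R]_(n + n).

Lemma continuous_J F : continuous F -> continuous (fun x => J (F x)).
Proof.
move=> Fc; apply: continuous_mx => i j; rewrite [i]ord1 => x.
rewrite (_ : (fun _ => _) = (fun x => dot (- J (delta_mx 0 j)) (F x))).
  by apply: continuous_dot => //; exact: cst_continuous.
by apply: funext => y; rewrite -dot_delta dotJ dotNl.
Qed.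

Lemma continuous_omega F G :
  continuous F -> continuous G -> continuous (fun x => omega (F x) (G x)).
Proof. by move=> Fc Gc; apply: continuous_dot => //; exact: continuous_J. Qed.

Lemma continuous_rot th F : continuous F -> continuous (fun x => rot th (F x)).
Proof.
move=> Fc; apply: continuous_add; apply: continuous_scale => //.
exact: continuous_J.
Qed.

End Continuity.

Lemma continuous_row (R : realType) (a b : nat) (i : 'I_a) :
  continuous (fun z : 'M[R]_(a, b) => row i z).
Proof.
apply: continuous_mx => k j.
have -> : (fun z : 'M[R]_(a, b) => row i z k j) = (fun z => z i j).
  by apply: funext => y; rewrite mxE.
exact: entry_continuous.
Qed.

(* [E] is [J] times the gradient of [g^2 / 2]. *)
Record smooth_norm (R : realType) (n : nat) (g : 'rV[R]_(n + n) -> R)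
    (E : 'rV[R]_(n + n) -> 'rV[R]_(n + n)) : Prop := SmoothNorm {
  snorm_continuous : continuous g;
  snorm_gt0 : forall x, x != 0 -> 0 < g x;
  snormZ : forall t x, g (t *: x) = `|t| * g x;
  omega_field : forall x, omega x (E x) = g x ^+ 2;
  omega_field_le : forall x y, omega y (E x) <= g x * g y;
  is_derive_snorm_sqr : forall x y t,
    is_derive t (1 : R) (fun t : R => g (x + t *: y) ^+ 2) (2 * omega y (E (x + t *: y)));
  field_continuous : continuous E;
  fieldZ : forall t x, E (t *: x) = t *: E x }.

Section SmoothNormTheory.
Variables (R : realType) (n : nat) (g : 'rV[R]_(n + n) -> R).
Variable E : 'rV[R]_(n + n) -> 'rV[R]_(n + n).
Hypothesis gE : smooth_norm g E.

Lemma snorm0 : g 0 = 0.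
Proof. by have := snormZ gE 0 0; rewrite scale0r normr0 mul0r. Qed.

Lemma snorm_ge0 x : 0 <= g x.
Proof.
by have [->|/(snorm_gt0 gE)/ltW//] := eqVneq x 0; rewrite snorm0.
Qed.

Lemma field0 : E 0 = 0.
Proof. by have := fieldZ gE 0 0; rewrite !scale0r. Qed.

Lemma snormN x : g (- x) = g x.
Proof. by rewrite -scaleN1r (snormZ gE) normrN1 mul1r. Qed.

End SmoothNormTheory.

Section SpectralDuality.
Variables (R : realType) (n m : nat).
Hypothesis m_gt1 : (1 < m)%N.

Let m_gt0 : (0 < m)%N. Proof. exact: ltnW. Qed.
Let mR : 0 < (m%:R : R). Proof. by rewrite ltr0n. Qed.

Local Notation V := 'rV[R]_(n + n).

Let I : pred 'I_m := fun k => (k == 0%N :> nat) || (ct R m k < 0).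

(** The spectral radius enters here: for [ct k < 0], dividing [ct k ^ 2 <= ct 0 ^ 2] by [ct k]
    reverses it. The inequality fails for [0 < ct k < ct 0], and for odd [m] one [ct k] is 0;
    neither kind belongs to [I]. *)
Let ctI k : I k -> ct R m k != 0 /\ ct R m 0 ^+ 2 / ct R m k <= ct R m k.
Proof.
have c0 := ct0_gt0 R m_gt0 m_gt1.
move=> /orP[/eqP ->|ck]; first by rewrite expr2 mulfK ?gt_eqF.
split; first by rewrite lt_eqF.
rewrite ler_ndivrMr // -expr2 -[leLHS]real_normK ?num_real //.
by rewrite lerXn2r ?nnegrE ?ct_bound // ltW.
Qed.

Let K (z : 'M[R]_(m, n + n)) : R :=
  \sum_(k | I k) dot (row k z) (row k z) / ct R m k.

Let U (z : 'M[R]_(m, n + n)) : 'I_m -> V := synth I (fun k => row k z).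

Let U_add z w j : U (z + w) j = U z j + U w j.
Proof.
by rewrite /U /synth -big_split; apply: eq_bigr => k _; rewrite linearD rotD.
Qed.

Let UZ t z j : U (t *: z) j = t *: U z j.
Proof.
rewrite /U /synth scaler_sumr; apply: eq_bigr => k _.
by rewrite linearZ rotZ.
Qed.

(* Let [W] be the span of the top eigenvectors and of the negative ones of the
   quadratic form [act].  On [W] its inverse [K] satisfies [ct 0 ^ 2 K <= act];
   if [u] maximizes [K] on [W] at fixed norm, then the dual vector [E u] has the
   same [W]-component as a multiple of [act^-1 u], and [act] is nonnegative on
   the orthogonal of [W]. *)
Lemma act_duality (g : V -> R) (E : V -> V) (N1 N2 : V -> R) (mu1 mu2 : R) :
  smooth_norm g E -> (0 < n)%N ->
  (forall x, 0 <= N1 (E x) <= g x) -> (forall x, 0 <= N2 x <= g x) ->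
  0 <= mu1 -> 0 <= mu2 ->
  (forall u : 'I_m -> V, act u <= mu1 * \sum_i N1 (u i) ^+ 2) ->
  (forall u : 'I_m -> V, act u <= mu2 * \sum_i N2 (u i) ^+ 2) ->
  ct R m 0 ^+ 2 <= mu1 * mu2.
Proof.
move=> gE n0 N1g N2g mu1_ge0 mu2_ge0 act1 act2.
have c0 := ct0_gt0 R m_gt0 m_gt1.
(* The rows of [z] are the Fourier coordinates of a polygon, and [C] stands for [W]. Writing it as
   the zero set of one continuous function makes closedness immediate. *)
pose C := [set z : 'M[R]_(m, n + n) | \sum_(k | ~~ I k) dot (row k z) (row k z) = 0].
pose Phi z := \sum_j g (U z j) ^+ 2.
have CP z : C z <-> forall k, ~~ I k -> row k z = 0.
  split => [/eqP|Cz]; last by rewrite /C /= big1 // => k /Cz ->; rewrite dot0l.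
  rewrite psumr_eq0 => [/allP Cz k nIk|k _]; last exact: dot_ge0.
  by have := Cz k (mem_index_enum _); rewrite nIk => /eqP/dot_eq0.
have Ccl : closed C.
  apply: (@closed_comp _ _ (fun z : 'M[R]_(m, n + n) =>
      \sum_(k | ~~ I k) dot (row k z) (row k z)) [set 0]); last exact: closed_eq.
  move=> z _; apply: continuous_sum => k _.
  by apply: continuous_dot; exact: continuous_row.
have Cs t z : C z -> C (t *: z).
  by move=> /CP Cz; apply/CP => k /Cz; rewrite linearZ /= => ->; rewrite scaler0.
have Kc : continuous K.
  apply: continuous_sum => k _; apply: continuous_mul; last exact: cst_continuous.
  by apply: continuous_dot; exact: continuous_row.
have Uc j : continuous (fun z => U z j).
  apply: continuous_sum => k _.
  by apply: continuous_rot; exact: continuous_row.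
have Pc : continuous Phi.
  apply: continuous_sum => j _.
  have Uj : continuous (fun z => g (U z j)).
    move=> z; apply: (@continuous_comp _ _ _ (fun z => U z j) g); first exact: Uc.
    exact: snorm_continuous gE _.
  exact: continuous_mul.
have Kh t z : K (t *: z) = t ^+ 2 * K z.
  rewrite mulr_sumr; apply: eq_bigr => k _.
  by rewrite linearZ /= dotZl dotZr; ring.
have Ph t z : Phi (t *: z) = t ^+ 2 * Phi z.
  rewrite mulr_sumr; apply: eq_bigr => j _.
  by rewrite UZ (snormZ gE) exprMn real_normK ?num_real.
have Pp z : C z -> z != 0 -> 0 < Phi z.
  move=> /CP Cz z0; rewrite lt_neqAle sumr_ge0 => [|j _]; last exact: sqr_ge0.
  rewrite andbT eq_sym; apply: contra z0; rewrite psumr_eq0 => [/allP P0|j _]; last exact: sqr_ge0.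
  have U0 j : U z j = 0.
    apply/eqP; apply: contraT => /(snorm_gt0 gE) gU.
    by have := P0 j (mem_index_enum _); rewrite /= expf_eq0 /= gt_eqF.
  apply/eqP/row_matrixP => k; rewrite row0.
  have [Ik|/Cz//] := boolP (I k).
  have := fourier_synth m_gt0 I (fun k => row k z) k.
  rewrite Ik /fourier big1 => [/esym/eqP|j _]; last by rewrite [synth _ _ _]U0 rot_0.
  by rewrite scaler_eq0 gt_eqF //= => /eqP.
pose e0 : V := delta_mx 0 (lshift n (Ordinal n0)).
have e00 : e0 != 0.
  apply/eqP => /rowP/(_ (lshift n (Ordinal n0)))/eqP.
  by rewrite !mxE !eqxx oner_eq0.
(* A pure top eigenvector: [K] is positive there, hence also at the maximizer, although [K] is
   indefinite on [W]. *)
pose z0 : 'M[R]_(m, n + n) := \matrix_k (if k == 0%N :> nat then e0 else 0).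
have z0r k : row k z0 = if k == 0%N :> nat then e0 else 0 by rewrite rowK.
have Cz0 : C z0 by apply/CP => k; rewrite /I negb_or z0r => /andP[/negbTE ->].
have Kz0 : 0 < K z0.
  rewrite /K (bigD1 (Ordinal m_gt0)) //= big1 => [|k /andP[_ k0]].
    by rewrite addr0 z0r /= divr_gt0 // dot_gt0.
  by rewrite z0r (_ : _ == _ :> nat = false) ?dot0l ?mul0r //; exact/negbTE.
have z00 : z0 != 0.
  by apply: contraTneq Kz0 => ->; have := Kh 0 0; rewrite scale0r expr0n mul0r => ->; rewrite ltxx.
have [z [Cz zn0 zmax]] := ratio_max Ccl Cs Kc Pc Kh Ph Pp Cz0 z00.
have Pz := Pp z Cz zn0.
have Kz : 0 < K z.
  rewrite -(pmulr_lgt0 _ (Pp _ Cz0 z00)).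
  by rewrite (lt_le_trans _ (zmax _ Cz0)) // mulr_gt0.
pose u := U z; pose p j := E (u j).
(* The Euler-Lagrange equation of the maximum of [K / Phi], tested on variations of the single
   frequency [k]: [phi] is nonnegative and vanishes at 0. It fixes the Fourier coefficients of the
   dual vector [p] on [I]. *)
have crit k : I k -> Phi z / ct R m k *: row k z = - (K z *: J (fourier k p)).
  move=> Ik; apply: dot_ext => a.
  pose w : 'M[R]_(m, n + n) := \matrix_l (if l == k then a else 0).
  have wr l : row l w = if l == k then a else 0 by rewrite rowK.
  have Cw : C w.
    apply/CP => l nIl; rewrite wr; case: eqP => // lk.
    by move: nIl; rewrite lk Ik.
  pose f (j : 'I_m) := rot (theta R m k * j%:R) a.
  have Uw j : U w j = f j.
    rewrite /U /synth (bigD1 k) //= big1 => [|l /andP[_ lk]].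
      by rewrite wr eqxx addr0.
    by rewrite wr (negbTE lk) rot_0.
  have KE t : K (z + t *: w) = K z + 2 * (dot (row k z) a / ct R m k) * t
                              + dot a a / ct R m k * t ^+ 2.
    rewrite /K (bigD1 k) //= [in RHS](bigD1 k) //=.
    rewrite linearD linearZ /= wr eqxx !dotDl !dotDr !dotZl !dotZr (dotC a (row k z)).
    rewrite (eq_bigr (fun k => dot (row k z) (row k z) / ct R m k)) => [|l /andP[_ lk]].
      ring.
    by rewrite linearD linearZ /= wr (negbTE lk) scaler0 addr0.
  pose phi (t : R) := K z * (\sum_j g (u j + t *: f j) ^+ 2)
    - Phi z * (K z + 2 * (dot (row k z) a / ct R m k) * t
                              + dot a a / ct R m k * t ^+ 2).
  have phi_ge0 t : 0 <= phi t.
    have Czw : C (z + t *: w).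
      apply/CP => l /[dup] nIl; move/CP: Cz => /[apply]; move/CP: Cw => /(_ _ nIl).
      by rewrite linearD linearZ /= => -> ->; rewrite scaler0 addr0.
    have PE : Phi (z + t *: w) = \sum_j g (u j + t *: f j) ^+ 2.
      by apply: eq_bigr => j _; rewrite U_add UZ Uw.
    by rewrite subr_ge0 -KE mulrC -PE zmax.
  have phi0 : phi 0 = 0.
    rewrite /phi expr0n !mulr0 !addr0 mulrC -mulrBl.
    rewrite (_ : \sum_j _ = Phi z) ?subrr ?mul0r //.
    by apply: eq_bigr => j _; rewrite scale0r addr0.
  have dphi (t : R) : is_derive t (1 : R) phi
     (K z * (\sum_j 2 * omega (f j) (E (u j + t *: f j)))
       - Phi z * (2 * (dot (row k z) a / ct R m k) + 2 * (dot a a / ct R m k * t))).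
    apply: is_deriveB.
      apply: is_deriveZ.
      have -> : (fun t => \sum_j g (u j + t *: f j) ^+ 2) =
                \sum_j (fun t : R => g (u j + t *: f j) ^+ 2).
        by apply: funext => s; rewrite fct_sumE.
      by apply: is_derive_sum => j; exact: is_derive_snorm_sqr gE _ _ _.
    by apply: is_derive_eq; rewrite /GRing.scale /=; ring.
  have d0 : is_derive (0 : R) (1 : R) phi 0.
    apply: (@derive1_at_min _ _ (-1) 1) => //.
    - by rewrite in_itv /= ltrN10 ltr01.
    - by move=> t _; rewrite phi0.
  have := @derive_val _ _ _ _ _ _ _ (dphi 0); rewrite (@derive_val _ _ _ _ _ _ _ d0).
  rewrite !mulr0 addr0.
  have -> : \sum_j 2 * omega (f j) (E (u j + 0 *: f j)) = - 2 * dot a (J (fourier k p)).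
    rewrite dotJ mulrNN /fourier dot_sumr mulr_sumr; apply: eq_bigr => j _.
    by rewrite scale0r addr0 omega_rot -omegaE.
  by rewrite dotNr !dotZr (dotC (row k z)) => H; lra.
have sqr_crit k : I k ->
    ct R m k * dot (fourier k p) (fourier k p) =
    Phi z ^+ 2 / K z ^+ 2 * (dot (row k z) (row k z) / ct R m k).
  move=> Ik; have [ck _] := ctI Ik.
  have := congr1 (fun x => dot x x) (crit k Ik).
  rewrite dotNl dotNr opprK !dotZl !dotZr dotJJ => H.
  have Kn0 : K z != 0 by rewrite gt_eqF.
  have -> : dot (fourier k p) (fourier k p) =
    (K z * (K z * dot (fourier k p) (fourier k p))) / K z ^+ 2 by field.
  by rewrite -H; field; rewrite ck.
(* The coefficients on [I] are given by [crit]; those outside are unknown, but their eigenvalues are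
   nonnegative and are discarded. *)
have actp : Phi z ^+ 2 / K z <= m%:R * act p.
  rewrite act_fourier // (bigID I) /= (eq_bigr _ sqr_crit) -mulr_sumr.
  have -> : Phi z ^+ 2 / K z = Phi z ^+ 2 / K z ^+ 2 * K z by field; rewrite gt_eqF.
  rewrite lerDl sumr_ge0 // => k; rewrite /I negb_or -leNgt => /andP[_ ck].
  by rewrite mulr_ge0 ?dot_ge0.
have actu : m%:R ^+ 2 * (ct R m 0 ^+ 2 * K z) <= m%:R * act u.
  rewrite act_fourier // (bigID I) /= [X in _ + X]big1 ?addr0 => [|k nIk].
    rewrite /K !mulr_sumr; apply: ler_sum => k Ik.
    rewrite fourier_synth // Ik dotZl dotZr; set d := dot _ _.
    have -> : ct R m k * (m%:R * (m%:R * d)) = m%:R ^+ 2 * (ct R m k * d) by ring.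
    rewrite ler_pM2l ?exprn_gt0 //.
    have -> : ct R m 0 ^+ 2 * (d / ct R m k) = ct R m 0 ^+ 2 / ct R m k * d by ring.
    apply: ler_wpM2r; first exact: dot_ge0.
    by have [_] := ctI Ik.
  by rewrite fourier_synth // (negbTE nIk) dot0l mulr0.
have le1 : act p <= mu1 * Phi z.
  apply: le_trans (act1 p) _; apply: ler_wpM2l => //; apply: ler_sum => j _.
  by have /andP[N10 N1l] := N1g (u j); rewrite lerXn2r ?nnegrE // (le_trans N10).
have le2 : act u <= mu2 * Phi z.
  apply: le_trans (act2 u) _; apply: ler_wpM2l => //; apply: ler_sum => j _.
  by have /andP[N20 N2l] := N2g (u j); rewrite lerXn2r ?nnegrE // (le_trans N20).
(* The two bounds compare [Phi z] and [K z] in opposite directions; in their product these positive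
   numbers cancel. *)
have H1 : Phi z <= m%:R * mu1 * K z.
  have A : Phi z ^+ 2 <= m%:R * act p * K z by rewrite -ler_pdivrMr.
  rewrite -(ler_pM2l Pz) -expr2 (le_trans A) //.
  have -> : Phi z * (m%:R * mu1 * K z) = m%:R * (mu1 * Phi z) * K z by ring.
  by rewrite ler_pM2r // ler_pM2l.
have H2 : m%:R * (ct R m 0 ^+ 2 * K z) <= mu2 * Phi z.
  rewrite -(ler_pM2l mR).
  have -> : m%:R * (m%:R * (ct R m 0 ^+ 2 * K z)) =
            m%:R ^+ 2 * (ct R m 0 ^+ 2 * K z) by ring.
  by rewrite (le_trans actu) // ler_pM2l.
rewrite -(ler_pM2r (mulr_gt0 (mulr_gt0 mR Kz) Pz)).
have -> : ct R m 0 ^+ 2 * (m%:R * K z * Phi z) =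
  (m%:R * (ct R m 0 ^+ 2 * K z)) * Phi z by ring.
have -> : mu1 * mu2 * (m%:R * K z * Phi z) = (mu2 * Phi z) * (m%:R * mu1 * K z) by ring.
apply: ler_pM => //; apply: ltW => //; apply: mulr_gt0 => //.
by apply: mulr_gt0 => //; apply: exprn_gt0.
Qed.

End SpectralDuality.

(** * Clarke duality on polygons *)

Section DualNorm.
Variables (R : realType) (n : nat).
Local Notation V := 'rV[R]_(n + n).
Variables (g : V -> R) (E : V -> V).
Hypotheses (gE : smooth_norm g E) (n_gt0 : (0 < n)%N).

Lemma rV_neq0 : exists e : V, e != 0.
Proof.
exists (delta_mx 0 (lshift n (Ordinal n_gt0))).
apply/eqP => /rowP/(_ (lshift n (Ordinal n_gt0)))/eqP.
by rewrite !mxE !eqxx oner_eq0.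
Qed.

(** Comparison with the library norm, by maximizing the quotient of the squares, which have the
    degree that [ratio_max] requires. *)
Lemma snorm_coercive : exists2 C : R, 0 < C & forall x, `|x| <= C * g x.
Proof.
have [e e0] := rV_neq0.
have nc : continuous (fun x : V => `|x| ^+ 2).
  by apply: continuous_mul; exact: norm_continuous.
have gc : continuous (fun x : V => g x ^+ 2).
  by apply: continuous_mul; exact: snorm_continuous gE.
have nh t (x : V) : `|t *: x| ^+ 2 = t ^+ 2 * `|x| ^+ 2.
  by rewrite normrZ exprMn real_normK ?num_real.
have gh t (x : V) : g (t *: x) ^+ 2 = t ^+ 2 * g x ^+ 2.
  by rewrite (snormZ gE) exprMn real_normK ?num_real.
have gp (x : V) : setT x -> x != 0 -> 0 < g x ^+ 2.
  by move=> _ /(snorm_gt0 gE) gx; rewrite exprn_gt0.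
have [z [_ z0 zmax]] :=
  ratio_max closedT (fun _ _ _ => Logic.I) nc gc nh gh gp (Logic.I : setT e) e0.
have gz := snorm_gt0 gE z0.
exists (`|z| / g z); first by rewrite divr_gt0 ?normr_gt0.
move=> x; rewrite mulrAC ler_pdivlMr //.
rewrite -(ler_pXn2r (_ : (0 < 2)%N)) ?nnegrE ?mulr_ge0 ?(snorm_ge0 gE) //.
by rewrite !exprMn zmax.
Qed.

(** The gauge of the symplectic polar of the unit ball of [g]. *)
Definition dnorm (f : V) : R := sup [set omega x f | x in [set x | g x <= 1]].

Let S (f : V) : R := \sum_i `|J f 0 i|.

Let omega_bound x f : omega x f <= `|x| * S f.
Proof.
rewrite omegaC mulr_sumr -sumrN; apply: ler_sum => i _.
rewrite (le_trans (ler_norm _)) // normrN normrM mulrC.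
by rewrite ler_wpM2r // entry_le_norm.
Qed.

Let dnorm_has_sup f : has_sup [set omega x f | x in [set x | g x <= 1]].
Proof.
have [C C0 gC] := snorm_coercive.
split; first by exists (omega 0 f), 0 => //=; rewrite (snorm0 gE).
exists (C * S f) => _ [x /= gx <-]; rewrite (le_trans (omega_bound x f)) //.
rewrite ler_wpM2r ?sumr_ge0 //.
by rewrite (le_trans (gC x)) // -[leRHS]mulr1 ler_pM2l.
Qed.

Lemma omega_le_dnorm x f : omega x f <= g x * dnorm f.
Proof.
have [->|x0] := eqVneq x 0; first by rewrite omega0l (snorm0 gE) mul0r.
have gx := snorm_gt0 gE x0.
rewrite mulrC -ler_pdivrMr // mulrC -omegaZl.
apply: ub_le_sup; first by case: (dnorm_has_sup f).
exists ((g x)^-1 *: x) => //=.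
by rewrite (snormZ gE) gtr0_norm ?invr_gt0 // mulVf // gt_eqF.
Qed.

Lemma dnorm_le f c : 0 <= c -> (forall x, omega x f <= c * g x) -> dnorm f <= c.
Proof.
move=> c0 fc; apply: ge_sup; first by case: (dnorm_has_sup f).
move=> _ [x /= gx <-]; rewrite (le_trans (fc x)) // -[leRHS]mulr1.
by rewrite ler_wpM2l.
Qed.

Lemma dnorm_ge0 f : 0 <= dnorm f.
Proof.
apply: ub_le_sup; first by case: (dnorm_has_sup f).
by exists 0; rewrite /= ?(snorm0 gE) // omega0l.
Qed.

Lemma dnorm_gt0 f : f != 0 -> 0 < dnorm f.
Proof.
move=> f0; have := omega_le_dnorm (- J f) f.
rewrite /omega JN JJ opprK => H.
rewrite lt_neqAle dnorm_ge0 andbT; apply/negP => /eqP d0; move: H.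
by rewrite -d0 mulr0 leNgt dot_gt0.
Qed.

Lemma dnormD f f' : dnorm (f + f') <= dnorm f + dnorm f'.
Proof.
apply: dnorm_le; first by rewrite addr_ge0 ?dnorm_ge0.
move=> x; rewrite omegaDr mulrC mulrDr.
by rewrite lerD ?omega_le_dnorm.
Qed.

Lemma dnormZ t f : dnorm (t *: f) = `|t| * dnorm f.
Proof.
have H s f' : dnorm (s *: f') <= `|s| * dnorm f'.
  apply: dnorm_le; first by rewrite mulr_ge0 ?dnorm_ge0.
  move=> x; rewrite omegaZr -omegaZl (le_trans (omega_le_dnorm _ _)) //.
  by rewrite (snormZ gE) mulrAC.
apply/eqP; rewrite eq_le H /=.
have [->|t0] := eqVneq t 0; first by rewrite normr0 mul0r dnorm_ge0.
rewrite -ler_pdivlMl ?normr_gt0 // -normfV.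
by rewrite (le_trans _ (H _ _)) // scalerA mulVf // scale1r.
Qed.

Lemma dnorm_field x : dnorm (E x) <= g x.
Proof. by apply: dnorm_le => [|y]; [exact: snorm_ge0 gE _|exact: omega_field_le]. Qed.

Lemma dnorm_continuous : continuous dnorm.
Proof.
have [C C0 gC] := snorm_coercive.
have Sc : continuous S.
  apply: continuous_sum => i _ x.
  apply: (@continuous_comp _ _ _ (fun x : V => J x 0 i) Num.norm).
    by apply: continuous_entry; apply: continuous_J => y.
  exact: norm_continuous.
have dS f : dnorm f <= C * S f.
  apply: dnorm_le => [|x]; first by rewrite mulr_ge0 ?sumr_ge0 ?ltW.
  rewrite (le_trans (omega_bound x f)) // mulrAC ler_wpM2r ?sumr_ge0 //.
have dB f f' : `|dnorm f - dnorm f'| <= C * S (f - f').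
  rewrite (le_trans _ (dS _)) // ler_norml; apply/andP; split.
    rewrite lerNl opprB lerBlDr -[in leLHS](subrK f f') addrC.
    rewrite (le_trans (dnormD _ _)) // addrC lerD2r.
    by rewrite -(opprB f) -scaleN1r dnormZ normrN1 mul1r.
  by rewrite lerBlDr -[in leLHS](subrK f' f) dnormD.
apply: (continuous_dominated _ _ dB) => [f|f]; last first.
  by rewrite subrr /S big1 ?mulr0 // => i _; rewrite J0 mxE normr0.
apply: continuous_mul; first exact: cst_continuous.
move=> y; apply: (@continuous_comp _ _ _ (fun y : V => f - y) S); last exact: Sc.
apply: continuous_add; first exact: cst_continuous.
by move=> z; exact: opp_continuous.
Qed.

End DualNorm.

Lemma is_derive_min0 (R : realType) (phi dphi : R -> R) :
  (forall t, is_derive t (1 : R) phi (dphi t)) ->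
  (forall t, phi 0 <= phi t) -> dphi 0 = 0.
Proof.
move=> d m.
have d0 : is_derive (0 : R) (1 : R) phi 0.
  apply: (@derive1_at_min _ _ (-1) 1) => //.
  by rewrite in_itv /= ltrN10 ltr01.
by rewrite -(@derive_val _ _ _ _ _ _ _ (d 0)) (@derive_val _ _ _ _ _ _ _ d0).
Qed.

(** * Maximizers of the discrete action solve the trapezoidal scheme *)

Section DiscreteOrbit.
Variables (R : realType) (n m : nat).
Local Notation V := 'rV[R]_(n + n).
Variables (g : V -> R) (E : V -> V).
Hypotheses (gE : smooth_norm g E) (n_gt0 : (0 < n)%N) (m_gt1 : (1 < m)%N).

Let m_gt0 : (0 < m)%N. Proof. exact: ltnW. Qed.
Let mR : 0 < (m%:R : R). Proof. by rewrite ltr0n. Qed.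

Local Notation N := (dnorm g).

Lemma sgC (i j : 'I_m) : sg R i j = - sg R j i.
Proof. by rewrite /sg opprB. Qed.

Let act2 (u v : 'I_m -> V) : R := \sum_i \sum_j sg R i j * omega (u j) (v i).

Let act2C u v : act2 u v = act2 v u.
Proof.
rewrite /act2 exchange_big /=; apply: eq_bigr => i _; apply: eq_bigr => j _.
by rewrite sgC omegaC mulrNN.
Qed.

Let actD u v : act (fun i => u i + v i) = act u + 2 * act2 u v + act v.
Proof.
rewrite [2 * _]mulr_natl mulr2n [X in _ + (_ + X)]act2C.
rewrite /act /act2 -!big_split /=; apply: eq_bigr => i _.
rewrite -!big_split /=; apply: eq_bigr => j _.
rewrite omegaDl !omegaDr; ring.
Qed.

(** Twice the midpoint of the [i]-th edge; up to [J], half the gradient of [act] in that edge. The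
    index is a natural number, so that [qn e i.+1] can be written without a bound. *)
Let qn (e : 'I_m -> V) (i : nat) : V :=
  \sum_(j < m) (((j < i)%N%:R : R) - (i < j)%N%:R) *: e j.

(** The dependence on one edge has no quadratic term, since [omega a a = 0]. The maximality
    condition in each edge is therefore a concave problem. *)
Let act_single u i (a : V) :
  act (fun k => u k + (if k == i then a else 0)) = act u + 2 * omega (qn u i) a.
Proof.
rewrite actD -addrA; congr (_ + _).
have -> : act2 u (fun k => if k == i then a else 0) = omega (qn u i) a.
  rewrite /act2 (bigD1 i) //= eqxx [X in _ + X]big1 ?addr0 => [|k /negbTE ki].
    by rewrite /qn omega_suml; apply: eq_bigr => j _; rewrite omegaZl.
  by apply: big1 => j _; rewrite ki omega0r mulr0.
rewrite /act big1 ?addr0 // => k _; apply: big1 => j _.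
case: eqP => [->|_]; last by rewrite omega0l mulr0.
case: eqP => [->|_]; last by rewrite omega0r mulr0.
by rewrite omegaxx mulr0.
Qed.

(** Legendre duality. Differentiability is available for [g] and not for [N], so the critical
    equation is read on the side of [g]: maximality forces equality in the Fenchel inequality, hence
    [q] minimizes [g ^ 2 / mu - 2 omega (., e)], and the derivative in [q] identifies [e]. *)
Let field_of_argmax mu q e : 0 < mu ->
  (forall f, 2 * omega q f - mu * N f ^+ 2 <= 2 * omega q e - mu * N e ^+ 2) ->
  e = mu^-1 *: E q.
Proof.
move=> mu0 He.
have H1 : g q ^+ 2 / mu <= 2 * omega q e - mu * N e ^+ 2.
  rewrite (le_trans _ (He (mu^-1 *: E q))) // omegaZr (omega_field gE).
  rewrite (dnormZ gE n_gt0) gtr0_norm ?invr_gt0 // exprMn.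
  have : N (E q) ^+ 2 <= g q ^+ 2.
    by rewrite lerXn2r ?nnegrE ?(dnorm_ge0 gE n_gt0) ?(dnorm_field gE n_gt0) ?(snorm_ge0 gE).
  have -> : mu * (mu^-1 ^+ 2 * N (E q) ^+ 2) = N (E q) ^+ 2 / mu.
    by field; rewrite gt_eqF.
  rewrite -(ler_pM2r (_ : 0 < mu^-1)) ?invr_gt0 // => H; lra.
have H2 x : 2 * omega x e <= g x ^+ 2 / mu + mu * N e ^+ 2.
  have := omega_le_dnorm gE n_gt0 x e; have := sqr_ge0 (g x - mu * N e) => sq H.
  have : 0 <= (g x - mu * N e) ^+ 2 / mu by rewrite divr_ge0 // ltW.
  have -> : (g x - mu * N e) ^+ 2 / mu = g x ^+ 2 / mu - 2 * (g x * N e) + mu * N e ^+ 2.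
    by field; rewrite gt_eqF.
  lra.
apply: omega_ext => y.
pose phi (t : R) := mu^-1 * g (q + t *: y) ^+ 2 - 2 * omega y e * t.
have dphi (t : R) : is_derive t (1 : R) phi
    (mu^-1 * (2 * omega y (E (q + t *: y))) - 2 * omega y e).
  apply: is_deriveB.
    by apply: is_deriveZ; exact: is_derive_snorm_sqr gE _ _ _.
  by apply: is_derive_eq; rewrite /GRing.scale /=; ring.
have := is_derive_min0 dphi; rewrite scale0r addr0 omegaZr => H.
suff /H : forall t, phi 0 <= phi t by lra.
move=> t; rewrite /phi scale0r addr0 mulr0 subr0.
have := H2 (q + t *: y); rewrite omegaDl omegaZl; lra.
Qed.

(** At a maximizer each edge is [mu^-1 *: E] of its doubled midpoint, and consecutive doubled
    midpoints differ by the sum of their two edges. This is the trapezoidal rule with time step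
    [2 / mu]. *)
Lemma discrete_orbit : exists (mu : R) (q : nat -> V), [/\ 0 < mu,
    forall u : 'I_m -> V, act u <= mu * \sum_i N (u i) ^+ 2,
    forall i, q i.+1 - q i = mu^-1 *: (E (q i) + E (q i.+1)) &
    [/\ forall i, q (i + m)%N = - q i, forall i, g (q i) <= 1 & g (q 0%N) = 1]].
Proof.
pose rows (z : 'M[R]_(m, n + n)) (i : 'I_m) : V := row i z.
pose Phi z := \sum_i N (rows z i) ^+ 2.
have rowsK u : rows (\matrix_i u i) = u by apply: funext => i; rewrite /rows rowK.
have fc : continuous (fun z => act (rows z)).
  apply: continuous_sum => i _; apply: continuous_sum => j _.
  apply: continuous_mul; first exact: cst_continuous.
  by apply: continuous_omega; exact: continuous_row.
have Pc : continuous Phi.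
  apply: continuous_sum => i _.
  have Nr : continuous (fun z => N (rows z i)).
    move=> z; apply: (@continuous_comp _ _ _ (fun z => rows z i) N).
      exact: continuous_row.
    exact: dnorm_continuous gE n_gt0 _.
  exact: continuous_mul.
have fh t z : act (rows (t *: z)) = t ^+ 2 * act (rows z).
  rewrite mulr_sumr; apply: eq_bigr => i _; rewrite mulr_sumr.
  by apply: eq_bigr => j _; rewrite /rows !linearZ /= omegaZl omegaZr; ring.
have Ph t z : Phi (t *: z) = t ^+ 2 * Phi z.
  rewrite mulr_sumr; apply: eq_bigr => i _.
  by rewrite /rows linearZ /= (dnormZ gE n_gt0) exprMn real_normK ?num_real.
have Pp z : setT z -> z != 0 -> 0 < Phi z.
  move=> _ z0; rewrite lt_neqAle sumr_ge0 => [|j _]; last exact: sqr_ge0.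
  rewrite andbT eq_sym; apply: contra z0.
  rewrite psumr_eq0 => [/allP P0|j _]; last exact: sqr_ge0.
  apply/eqP/row_matrixP => i; rewrite row0; apply/eqP; apply: contraT.
  move=> /(dnorm_gt0 gE n_gt0) Ni; have := P0 i (mem_index_enum _).
  by rewrite /= expf_eq0 /= gt_eqF.
have [e0 e00] := rV_neq0 R n_gt0.
pose u0 : 'I_m -> V := synth (fun k : 'I_m => k == 0%N :> nat) (fun=> e0).
have act0 : 0 < act u0.
  rewrite -(pmulr_rgt0 _ mR) act_fourier // (bigD1 (Ordinal m_gt0)) //=.
  rewrite big1 ?addr0 => [|k k0].
    have := fourier_synth m_gt0 (fun k : 'I_m => k == 0%N :> nat) (fun=> e0) (Ordinal m_gt0).
    rewrite /= => ->; rewrite mulr_gt0 ?ct0_gt0 // dot_gt0 //.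
    by rewrite scaler_eq0 negb_or gt_eqF.
  rewrite fourier_synth // (_ : _ == _ = false) ?dot0l ?mulr0 //.
  exact/negbTE.
pose z0 : 'M[R]_(m, n + n) := \matrix_i u0 i.
have z00 : z0 != 0.
  apply: contraTneq act0 => z00; rewrite -(rowsK u0) -/z0 z00.
  by have := fh 0 0; rewrite scale0r expr0n mul0r => ->; rewrite ltxx.
have [z [_ zn0 zmax]] :=
  ratio_max closedT (fun _ _ _ => Logic.I) fc Pc fh Ph Pp (Logic.I : setT z0) z00.
have Pz := Pp z Logic.I zn0.
pose e := rows z; pose mu := act e / Phi z.
have mu_max (u : 'I_m -> V) : act u <= mu * \sum_i N (u i) ^+ 2.
  have := zmax (\matrix_i u i) Logic.I; rewrite rowsK /Phi rowsK => H.
  by rewrite mulrAC ler_pdivlMr.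
have mu0 : 0 < mu.
  have := lt_le_trans act0 (mu_max u0).
  by rewrite pmulr_lgt0 // (lt_le_trans _ (_ : Phi z0 <= _)) ?Pp // /Phi rowsK.
have eE i : e i = mu^-1 *: E (qn e i).
  apply: field_of_argmax => // f.
  (* The variation replaces the edge [e i] by an arbitrary [f]. *)
  have := mu_max (fun k => e k + (if k == i then f - e i else 0)).
  rewrite act_single omegaDr omegaNr.
  have -> : act e = mu * Phi z by rewrite /mu divfK // gt_eqF.
  rewrite /Phi (bigD1 i) //= [in leRHS](bigD1 i) //= eqxx subrKC.
  rewrite [X in N f ^+ 2 + X](eq_bigr (fun k => N (rows z k) ^+ 2)) => [|k /negbTE ki].
    by rewrite -/(e i) !mulrDr => H; lra.
  by rewrite ki addr0.
have qS (i : 'I_m) (i' : 'I_m) : i' = i.+1 :> nat -> qn e i.+1 - qn e i = e i + e i'.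
  move=> ii'; rewrite /qn -sumrB (bigD1 i) //= (bigD1 i') /=; last first.
    by apply/eqP => /(congr1 val) /=; lia.
  rewrite big1 ?addr0 => [|j /andP[ji ji']]; last first.
    rewrite -scalerBl; have {}ji : (j : nat) <> i by move=> /val_inj; apply/eqP.
    have {}ji' : (j : nat) <> i.+1 by rewrite -ii' => /val_inj; apply/eqP.
    have -> : (j < i.+1)%N = (j < i)%N by lia.
    have -> : (i.+1 < j)%N = (i < j)%N by lia.
    by rewrite subrr scale0r.
  rewrite -!scalerBl ii' !ltnn ltnSn.
  have -> : (i.+1 < i)%N = false by lia.
  by rewrite !subr0 !sub0r opprK !scale1r.
(* The wrap-around: the midpoint that follows the last one is [- qn e 0], and the edge that follows
   is the opposite of the edge 0. *)
have q_last (i i' : 'I_m) : i = 0%N :> nat -> i'.+1 = m -> - qn e 0 - qn e i' = e i' - e i.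
  move=> i0 i'm; rewrite /qn -sumrN -sumrB.
  pose F (j : 'I_m) : V := (if j == i' then e j else 0) - (if j == i then e j else 0).
  rewrite (eq_bigr F) => [|j _].
    rewrite /F sumrB -!big_mkcond /= !big_pred1_eq //.
  rewrite /F -scaleNr -scalerBl ltn0 sub0r opprK.
  have -> : (i' < j)%N = false by have := ltn_ord j; lia.
  have -> : (j == i) = (j == 0%N :> nat) by rewrite -val_eqE /= i0.
  have -> : (j == i') = ~~ (j < i')%N.
    by rewrite -val_eqE /=; have := ltn_ord j; lia.
  rewrite subr0; case: (j : nat) => [|k] /=.
    by case: (0 < i')%N;
      rewrite /= ?(mulr0n, mulr1n, sub0r, oppr0, subr0, subrr, scaleN1r, scale0r).
  by case: (_ < i')%N;
    rewrite /= ?(mulr0n, mulr1n, oppr0, subrr, subr0, scale0r, scale1r).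
pose Q k : V := (-1) ^+ (k %/ m) *: qn e (k %% m).
have QD k : Q (k + m)%N = - Q k.
  by rewrite /Q divnDr // divnn m_gt0 addn1 modnDr exprS mulN1r scaleNr.
have EQ k : mu^-1 *: E (Q k) = (-1) ^+ (k %/ m) *: e (Ordinal (ltn_pmod k m_gt0)).
  by rewrite /Q (fieldZ gE) eE /= !scalerA mulrC.
have QS k : Q k.+1 - Q k = mu^-1 *: (E (Q k) + E (Q k.+1)).
  rewrite scalerDr !EQ.
  set e1 := e (Ordinal (ltn_pmod k m_gt0)).
  set e2 := e (Ordinal (ltn_pmod k.+1 m_gt0)).
  have [r1|r1] := ltnP (k %% m)%N.+1 m.
    have kd : (k.+1 %/ m = k %/ m)%N.
      by rewrite {1}(divn_eq k m) -addnS divnMDl // [(_.+1 %/ _)%N]divn_small ?addn0.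
    have km : (k.+1 %% m = (k %% m).+1)%N.
      by rewrite {1}(divn_eq k m) -addnS modnMDl modn_small.
    rewrite /Q kd km -scalerBr -scalerDr; congr (_ *: _).
    exact: (qS (Ordinal (ltn_pmod k m_gt0)) (Ordinal (ltn_pmod k.+1 m_gt0)) km).
  have r1m : (k %% m)%N.+1 = m by have := ltn_pmod k m_gt0; lia.
  have kd : (k.+1 %/ m = (k %/ m).+1)%N.
    by rewrite {1}(divn_eq k m) -addnS r1m divnMDl // divnn m_gt0 addn1.
  have km : (k.+1 %% m = 0)%N.
    by rewrite {1}(divn_eq k m) -addnS r1m modnMDl modnn.
  rewrite /Q kd km exprS mulN1r !scaleNr -!scalerN -!scalerDr; congr (_ *: _).
  exact: (q_last (Ordinal (ltn_pmod k.+1 m_gt0)) (Ordinal (ltn_pmod k m_gt0)) km r1m).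
have gQ k : g (Q k) = g (qn e (k %% m)).
  by rewrite (snormZ gE) normrX normrN1 expr1n mul1r.
(* The scheme is not shown to keep [g] constant. Starting at an index where [g] is largest and
   dividing by that value gives [g (q 0) = 1] and [g <= 1] together. *)
pose i0 := [arg max_(i > Ordinal m_gt0) g (qn e (i : 'I_m))]%O.
have i0max i : g (qn e (i : 'I_m)) <= g (qn e i0).
  by rewrite /i0; case: arg_maxP => // j _; apply.
pose la := g (qn e i0).
have la0 : 0 < la.
  rewrite lt_neqAle (snorm_ge0 gE) andbT; apply: contra zn0 => /eqP la0.
  apply/eqP/row_matrixP => i; rewrite row0 -/(rows z i) -/(e i) eE.
  have [->|/(snorm_gt0 gE)] := eqVneq (qn e i) 0.
    by rewrite (field0 gE) scaler0.
  by rewrite ltNge la0 i0max.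
exists mu, (fun k => la^-1 *: Q (k + i0)%N); split => //.
  move=> i; rewrite addSn -scalerBr QS !(fieldZ gE) -scalerDr !scalerA.
  by rewrite mulrC.
split=> [i|i|].
- by rewrite addnAC QD scalerN.
- rewrite (snormZ gE) gQ gtr0_norm ?invr_gt0 // mulrC ler_pdivrMr // mul1r.
  exact: (i0max (Ordinal (ltn_pmod (i + i0) m_gt0))).
- rewrite (snormZ gE) gQ add0n modn_small // gtr0_norm ?invr_gt0 //.
  by rewrite mulVf // gt_eqF.
Qed.

End DiscreteOrbit.

(** * The limit of the polygons *)

Lemma natr_dist_between (R : realType) (i j c : nat) :
  (minn i j <= c <= maxn i j)%N ->
  `|j%:R - c%:R| <= `|i%:R - j%:R| :> R.
Proof.
have [ij|/ltnW ji] := leqP i j.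
  move=> /andP[ic cj].
  by rewrite [leRHS]distrC -!natrB // !normr_nat ler_nat leq_sub2l.
move=> /andP[jc ci].
by rewrite distrC -!natrB // !normr_nat ler_nat leq_sub2r.
Qed.

Lemma ultra_fmap (T T' : Type) (f : T -> T') (U : set_system T) :
  UltraFilter U -> UltraFilter (f @ U).
Proof.
move=> UU; have UP : ProperFilter U by exact: ultra_proper.
split; first exact: fmap_proper_filter.
move=> G GP sUG; apply/seteqP; split => // A GA.
have [//|UnA] := in_ultra_setVsetC (f @^-1` A) UU.
have : G (A `&` ~` A) by apply: filterI => //; exact: sUG.
by rewrite setICr => /filter_not_empty.
Qed.

Lemma is_derive_of_bound (R : realType) (V : normedModType R) (f : R -> V)
    (t : R) (v : V) :
  (forall e, 0 < e -> exists2 d, 0 < d &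
     forall s, `|s - t| < d -> `|f s - f t - (s - t) *: v| <= e * `|s - t|) ->
  is_derive t (1 : R) f v.
Proof.
move=> H.
have c : h^-1 *: ((f \o shift t) (h *: 1) - f t) @[h --> (0:R)^'] --> v.
  apply/cvgrPdist_le => e e0; have [d d0 Hd] := H e e0.
  near=> h.
  have h0 : h != 0 by near: h; exact: nbhs_dnbhs_neq.
  have hd : `|h| < d.
    by near: h; exact: dnbhs0_lt.
  have := Hd (h + t); rewrite addrK => /(_ hd).
  rewrite /= [h *: 1]mulr1 => Hh.
  have -> : v - h^-1 *: (f (h + t) - f t) = - (h^-1 *: (f (h + t) - f t - h *: v)).
    by rewrite [in RHS]scalerBr scalerA mulVf // scale1r opprB.
  by rewrite normrN normrZ normfV mulrC ler_pdivrMr ?normr_gt0.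
apply: DeriveDef; first by apply/cvg_ex; exists v.
exact: (cvg_lim _ c).
Unshelve. all: by end_near. Qed.

Section LimitOrbit.
Variables (R : realType) (n : nat).
Local Notation V := 'rV[R]_(n + n).
Variables (g : V -> R) (E : V -> V).
Hypotheses (gE : smooth_norm g E) (n_gt0 : (0 < n)%N).

Lemma field_bounded : exists2 B : R, 0 < B & forall x, `|E x| <= B * g x.
Proof.
have [e e0] := rV_neq0 R n_gt0.
have nc : continuous (fun x : V => `|E x|).
  move=> x; apply: (@continuous_comp _ _ _ E Num.norm).
    exact: field_continuous gE _.
  exact: norm_continuous.
have nc2 : continuous (fun x : V => `|E x| ^+ 2) by exact: continuous_mul.
have gc : continuous (fun x : V => g x ^+ 2).
  by apply: continuous_mul; exact: snorm_continuous gE.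
have nh t (x : V) : `|E (t *: x)| ^+ 2 = t ^+ 2 * `|E x| ^+ 2.
  by rewrite (fieldZ gE) normrZ exprMn real_normK ?num_real.
have gh t (x : V) : g (t *: x) ^+ 2 = t ^+ 2 * g x ^+ 2.
  by rewrite (snormZ gE) exprMn real_normK ?num_real.
have gp (x : V) : setT x -> x != 0 -> 0 < g x ^+ 2.
  by move=> _ /(snorm_gt0 gE) gx; rewrite exprn_gt0.
have [z [_ z0 zmax]] :=
  ratio_max closedT (fun _ _ _ => Logic.I) nc2 gc nh gh gp (Logic.I : setT e) e0.
have gz := snorm_gt0 gE z0.
have b0 : 0 <= `|E z| / g z by rewrite divr_ge0 // ltW.
(* The added 1 makes the constant positive without any knowledge of [E z]. *)
exists (`|E z| / g z + 1); first by rewrite ltr_wpDl.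
move=> x; rewrite (@le_trans _ _ (`|E z| / g z * g x)) //; last first.
  by rewrite ler_wpM2r ?(snorm_ge0 gE) // lerDl.
rewrite mulrAC ler_pdivlMr //.
rewrite -(ler_pXn2r (_ : (0 < 2)%N)) ?nnegrE ?mulr_ge0 ?(snorm_ge0 gE) //.
by rewrite !exprMn zmax.
Qed.

Variables (tau : nat -> R) (q : nat -> nat -> V).
Hypothesis tau_gt0 : forall k, 0 < tau k.
Hypothesis step : forall k i,
  q k i.+1 - q k i = (tau k / 2) *: (E (q k i) + E (q k i.+1)).
Hypothesis anti : forall k i, q k (i + k.+2)%N = - q k i.
Hypothesis q_le1 : forall k i, g (q k i) <= 1.
Hypothesis q0_1 : forall k, g (q k 0) = 1.

(** Points in the unit ball have fields of norm at most [B]. The bound is uniform in [k], which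
    supplies the equicontinuity for the limit. *)
Lemma orbit_lipschitz (B : R) k i j : 0 < B -> (forall x, `|E x| <= B * g x) ->
  `|q k i - q k j| <= B * `|i%:R * tau k - j%:R * tau k|.
Proof.
move=> B0 EB.
have D a : `|q k a.+1 - q k a| <= B * tau k.
  have EB1 b : `|E (q k b)| <= B.
    by rewrite (le_trans (EB _)) // -[leRHS]mulr1 ler_pM2l.
  rewrite step normrZ gtr0_norm ?divr_gt0 //.
  have -> : B * tau k = tau k / 2 * (B + B) by field.
  by rewrite ler_pM2l ?divr_gt0 // (le_trans (ler_normD _ _)) // lerD.
wlog ij : i j / (i <= j)%N.
  move=> H; have [|/ltnW] := leqP i j; first exact: H.
  by rewrite distrC [X in _ * X]distrC; exact: H.
rewrite distrC [X in _ * X]distrC -mulrBl normrM (gtr0_norm (tau_gt0 k)).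
rewrite -natrB // normr_nat -(subnKC ij) addKn; elim: (j - i)%N => [|d IH].
  by rewrite addn0 subrr normr0 mul0r mulr0.
have -> : q k (i + d.+1)%N - q k i =
    (q k (i + d).+1 - q k (i + d)%N) + (q k (i + d)%N - q k i).
  by rewrite addnS addrA subrK.
rewrite (le_trans (ler_normD _ _)) //.
have -> : B * (d.+1%:R * tau k) = B * tau k + B * (d%:R * tau k).
  by rewrite -natr1; ring.
by rewrite lerD.
Qed.

(* Since [q (i + m) = - q i], the half-period cannot shrink to [0]. *)
Lemma period_ge : exists2 c : R, 0 < c & forall k, c <= k.+2%:R * tau k.
Proof.
have [B B0 EB] := field_bounded.
have [C C0 gC] := snorm_coercive gE n_gt0.
have gc : continuous g := snorm_continuous gE.
have [G G0 gG] : exists2 G : R, 0 < G & forall x, g x <= G * `|x|.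
  have [e e0] := rV_neq0 R n_gt0.
  have nc : continuous (fun x : V => `|x| ^+ 2).
    by apply: continuous_mul; exact: norm_continuous.
  have gc2 : continuous (fun x : V => g x ^+ 2) by exact: continuous_mul.
  have nh t (x : V) : `|t *: x| ^+ 2 = t ^+ 2 * `|x| ^+ 2.
    by rewrite normrZ exprMn real_normK ?num_real.
  have gh t (x : V) : g (t *: x) ^+ 2 = t ^+ 2 * g x ^+ 2.
    by rewrite (snormZ gE) exprMn real_normK ?num_real.
  have np (x : V) : setT x -> x != 0 -> 0 < `|x| ^+ 2.
    by move=> _ x0; rewrite exprn_gt0 // normr_gt0.
  have [z [_ z0 zmax]] :=
    ratio_max closedT (fun _ _ _ => Logic.I) gc2 nc gh nh np (Logic.I : setT e) e0.
  have nz : 0 < `|z| by rewrite normr_gt0.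
  exists (g z / `|z|); first by rewrite divr_gt0 // (snorm_gt0 gE).
  move=> x; rewrite mulrAC ler_pdivlMr //.
  rewrite -(ler_pXn2r (_ : (0 < 2)%N)) ?nnegrE ?mulr_ge0 ?(snorm_ge0 gE) //.
  by rewrite !exprMn zmax.
exists (2 / (G * B)); first by rewrite divr_gt0 ?mulr_gt0.
move=> k; rewrite ler_pdivrMr ?mulr_gt0 //.
have := orbit_lipschitz k k.+2 0 B0 EB; rewrite mul0r subr0.
rewrite [X in _ <= _ * X]gtr0_norm ?mulr_gt0 //; have := anti k 0; rewrite add0n => ->.
rewrite -opprD normrN -mulr2n -scaler_nat normrZ ger0_norm // => H.
have := gG (q k 0%N); rewrite q0_1 => H1.
have : G * (2 * `|q k 0%N|) <= G * (B * (k.+2%:R * tau k)) by rewrite ler_pM2l.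
lra.
Qed.

Variables (U : set_system nat) (P : R).
Hypotheses (UU : UltraFilter U) (Uoo : U --> \oo).
Hypothesis UP : k.+2%:R * tau k @[k --> U] --> P.

#[local] Instance U_proper : ProperFilter U := @ultra_proper _ U UU.

Let P_ge0 : 0 <= P.
Proof.
apply: (ler_cvg_to (cvg_cst (0 : R)) UP); apply: nearW => k.
by rewrite mulr_ge0 // ltW.
Qed.

Let tau0 : tau k @[k --> U] --> (0 : R).
Proof.
have H : k.+2%:R^-1 @[k --> U] --> (0 : R).
  have H : k.+2%:R^-1 @[k --> \oo] --> (0 : R).
    apply: (squeeze_cvgr _ (cvg_cst 0) (@cvg_harmonic R)); apply: nearW => k /=.
    by rewrite invr_ge0 ler0n /= lef_pV2 ?posrE // ler_nat.
  by move=> A /H/Uoo.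
rewrite -(mulr0 P); apply: cvg_trans (cvgM UP H).
by apply: near_eq_cvg; apply: nearW => k /=; field.
Qed.

(* [truncn] vanishes on negative numbers: [gam] is constant on the negative
   half-line. *)
Let idx (t : R) (k : nat) := Num.truncn (t / tau k).
Let gam (t : R) : V := lim (q k (idx t k) @[k --> U]).

(** Along an ultrafilter every sequence in a compact set converges, so the limit curve is defined at
    all times at once, without extracting subsequences. *)
Let bounded_cvg (i : nat -> nat) : cvg (q k (i k) @[k --> U]).
Proof.
have [C C0 gC] := snorm_coercive gE n_gt0.
pose A := [set x : V | `|x| <= C].
have Ac : compact A.
  apply: (@mx_bounded_closed_compact _ _ _ A C) => //.
  apply: (@closed_comp _ _ (fun z : V => `|z|) [set r | r <= C]).
    by move=> z _; exact: norm_continuous.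
  exact: closed_le.
move: Ac; rewrite compact_ultra.
move=> /(_ ((fun k => q k (i k)) @ U) (ultra_fmap _ UU)).
case=> [|p [_ qp]]; last by apply/cvg_ex; exists p.
have : \forall k \near U, A (q k (i k)).
  apply: nearW => k; rewrite /A /= (le_trans (gC _)) //.
  by rewrite -[leRHS]mulr1 ler_pM2l.
exact.
Qed.

Let idx_cvg t : (idx t k)%:R * tau k @[k --> U] --> Num.max t 0.
Proof.
have [t0|t0] := leP 0 t.
  apply/cvgrPdist_le => e e0; near=> k.
  have tk : `|tau k| <= e by near: k; move/cvgr0Pnorm_le : tau0; exact.
  have /andP[l1 l2] := @truncn_itv _ (t / tau k) (divr_ge0 t0 (ltW (tau_gt0 k))).
  move: l1 l2; rewrite -/(idx t k) ler_pdivlMr // ltr_pdivrMr // => l1 l2.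
  rewrite ger0_norm ?subr_ge0 // (le_trans _ tk) // gtr0_norm //.
  by move: l2; rewrite -natr1 mulrDl mul1r; lra.
have -> : (fun k => (idx t k)%:R * tau k) = (fun=> 0).
  apply: funext => k; rewrite /idx (_ : Num.truncn _ = 0%N) ?mul0r //.
  by apply/truncn0Pn; rewrite -ltNge ltr_pdivrMr // mul1r (lt_trans t0).
exact: cvg_cst.
Unshelve. all: by end_near. Qed.

(** By equicontinuity the limit depends only on the limit of the times [i k * tau k]. Exact indices
    can thus be used at time 0 and at the full period. *)
Let q_at (i : nat -> nat) (t : R) : (i k)%:R * tau k @[k --> U] --> Num.max t 0 ->
  q k (i k) @[k --> U] --> gam t.
Proof.
move=> it; have [B B0 EB] := field_bounded.
have H : q k (idx t k) @[k --> U] --> gam t := @bounded_cvg (idx t).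
have D : q k (i k) - q k (idx t k) @[k --> U] --> (0 : V).
  apply/cvgr0Pnorm_le => e e0.
  have : (i k)%:R * tau k - (idx t k)%:R * tau k @[k --> U] --> (0 : R).
    by rewrite -(subrr (Num.max t 0)); apply: cvgB it (@idx_cvg t).
  move/cvgr0Pnorm_le => /(_ (e / B)); rewrite divr_gt0 // => /(_ isT).
  apply: filterS => k; rewrite ler_pdivlMr // => Hk.
  by rewrite (le_trans (orbit_lipschitz _ _ _ B0 EB)) // mulrC.
rewrite -[gam t]add0r; apply: cvg_trans (cvgD D H).
by apply: near_eq_cvg; apply: nearW => k /=; rewrite subrK.
Qed.

Let gam_lip B : 0 < B -> (forall x, `|E x| <= B * g x) ->
  forall s t : R, `|gam s - gam t| <= B * `|Num.max s 0 - Num.max t 0|.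
Proof.
move=> B0 EB s t.
apply: (ler_cvg_to (cvg_norm (cvgB (@bounded_cvg (idx s)) (@bounded_cvg (idx t))))
  (cvgM (cvg_cst B) (cvg_norm (cvgB (@idx_cvg s) (@idx_cvg t))))); apply: nearW => k /=.
exact: orbit_lipschitz.
Qed.

(** A mean value inequality for the polygon: each trapezoidal increment is close to [tau k *: v].
    Both orders of [i] and [j] are covered, as a two-sided derivative requires. *)
Let step_sum k (v : V) (e : R) i j : 0 <= e ->
  (forall c, (minn i j <= c <= maxn i j)%N -> `|E (q k c) - v| <= e) ->
  `|q k i - q k j - (i%:R * tau k - j%:R * tau k) *: v|
    <= e * `|i%:R * tau k - j%:R * tau k|.
Proof.
move=> e0; wlog ij : i j / (j <= i)%N.
  move=> H Ec; have [|/ltnW ij] := leqP j i; first by move=> ?; exact: H.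
  rewrite [X in _ <= _ * X]distrC.
  rewrite (_ : _ - _ - _ = - (q k j - q k i - (j%:R * tau k - i%:R * tau k) *: v)).
    by rewrite normrN H // minnC maxnC.
  by rewrite !scalerBl; apply/rowP => l; rewrite !mxE; ring.
rewrite (minn_idPr ij) (maxn_idPl ij) -mulrBl normrM (gtr0_norm (tau_gt0 k)).
rewrite -natrB // normr_nat -(subnKC ij) addKn.
elim: (i - j)%N => [|d IH] Ec.
  by rewrite addn0 !subrr !mul0r scale0r subr0 normr0 mulr0.
have EcS c : (j <= c <= j + d.+1)%N -> `|E (q k c) - v| <= e by exact: Ec.
have -> : q k (j + d.+1)%N - q k j - (d.+1%:R * tau k) *: v =
   (tau k / 2) *: ((E (q k (j + d)%N) - v) + (E (q k (j + d).+1) - v))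
   + (q k (j + d)%N - q k j - (d%:R * tau k) *: v).
  have -> : E (q k (j + d)%N) - v + (E (q k (j + d).+1) - v) =
      E (q k (j + d)%N) + E (q k (j + d).+1) - (2 : R) *: v.
    by apply/rowP => l; rewrite !mxE; ring.
  rewrite addnS scalerBr scalerA divfK // -step -natr1.
  by apply/rowP => l; rewrite !mxE; ring.
rewrite (le_trans (ler_normD _ _)) //.
have -> : e * (d.+1%:R * tau k) = e * tau k + e * (d%:R * tau k).
  by rewrite -[d.+1%:R]natr1; ring.
apply: lerD; last by apply: IH => c cj; apply: Ec; lia.
rewrite normrZ gtr0_norm ?divr_gt0 //.
have -> : e * tau k = tau k / 2 * (e + e) by field.
rewrite ler_pM2l ?divr_gt0 // (le_trans (ler_normD _ _)) // lerD // EcS //; lia.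
Qed.

Let gam_derive (t : R) : 0 < t -> is_derive t (1 : R) gam (E (gam t)).
Proof.
move=> t0; apply: is_derive_of_bound => e e0.
have [B B0 EB] := field_bounded.
have [d d0 Ed] : exists2 d : R, 0 < d &
    forall y, `|gam t - y| < d -> `|E y - E (gam t)| <= e.
  have /nbhs_ballP[d d0 dE] : nbhs (gam t) (E @^-1` ball (E (gam t)) e).
    by apply: (field_continuous gE); exact: nbhsx_ballx.
  exists d => // y yd; rewrite distrC; apply: ltW.
  by move: (dE y); rewrite /= -!ball_normE /=; exact.
(* The bound [t] keeps [s] positive. The bound [d / (4 * B)] leaves a factor 2 for the rounding of
   indices: times then differ by less than [d / (2 * B)], so intermediate points move by less than
   [d / 2]. *)
exists (Num.min t (d / (4 * B))).
  by rewrite lt_min t0 divr_gt0 // mulr_gt0.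
move=> s; rewrite lt_min => /andP[st sd].
have s0 : 0 < s by move: st; rewrite ltr_norml; lra.
have ms : Num.max s 0 = s by rewrite max_l // ltW.
have mt : Num.max t 0 = t by rewrite max_l // ltW.
have := @idx_cvg s; have := @idx_cvg t; rewrite ms mt => It Is.
have Qs : q k (idx s k) @[k --> U] --> gam s := @bounded_cvg (idx s).
have Qt : q k (idx t k) @[k --> U] --> gam t := @bounded_cvg (idx t).
have D : (idx s k)%:R * tau k - (idx t k)%:R * tau k @[k --> U] --> s - t.
  exact: cvgB Is It.
have H1 : `|q k (idx s k) - q k (idx t k)
    - ((idx s k)%:R * tau k - (idx t k)%:R * tau k) *: E (gam t)| @[k --> U]
    --> `|gam s - gam t - (s - t) *: E (gam t)|.
  apply: cvg_norm; apply: cvgB; first exact: cvgB Qs Qt.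
  by apply: cvgZr_tmp.
have H2 : e * `|(idx s k)%:R * tau k - (idx t k)%:R * tau k| @[k --> U]
    --> e * `|s - t|.
  by apply: cvgM; [exact: cvg_cst | exact: cvg_norm].
apply: (ler_cvg_to H1 H2); near=> k; rewrite /=; apply: step_sum; first exact: ltW.
move=> c cij; apply: Ed.
have {H1 H2} H1 : `|gam t - q k (idx t k)| < d / 2.
  by near: k; move/cvgrPdist_lt : Qt; apply; rewrite divr_gt0.
have H2 : `|(idx s k)%:R * tau k - (idx t k)%:R * tau k| < d / (2 * B).
  near: k; apply: (cvgr_norm_lt _ D).
  rewrite (lt_trans sd) // ltr_pM2l // ltf_pV2 ?posrE ?mulr_gt0 //.
  by rewrite ltr_pM2r // ltr_nat.
rewrite -[gam t - _](subrKA (q k (idx t k))) (le_lt_trans (ler_normD _ _)) //.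
rewrite [ltRHS](splitr d) ltrD //.
rewrite (le_lt_trans (orbit_lipschitz _ _ _ B0 EB)) //.
have H3 : `|(idx t k)%:R * tau k - c%:R * tau k| <=
          `|(idx s k)%:R * tau k - (idx t k)%:R * tau k|.
  rewrite -!mulrBl !normrM ler_pM2r ?normr_gt0 ?gt_eqF //.
  exact: natr_dist_between.
rewrite mulrC -ltr_pdivlMr // -mulrA -invfM; exact: le_lt_trans H3 H2.
Unshelve. all: by end_near. Qed.

Lemma limit_orbit : exists gamma : R -> V,
  [/\ continuous gamma, gamma 0 = gamma (2 * P), g (gamma 0) = 1 &
      forall t : R, 0 < t -> is_derive t (1 : R) gamma (E (gamma t))].
Proof.
have [B B0 EB] := field_bounded.
exists gam; split => //.
- move=> t; apply/cvgrPdist_lt => e e0; near=> s.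
  rewrite (le_lt_trans (gam_lip B0 EB _ _)) // mulrC -ltr_pdivlMr //.
  apply: (@le_lt_trans _ _ `|t - s|).
    rewrite ler_norml; have := ler_norm (t - s); have := ler_norm (s - t).
    rewrite distrC => A1 A2.
    by case: (leP t 0); case: (leP s 0); lra.
  by near: s; apply: cvgr_dist_lt; [exact: cvg_id | rewrite divr_gt0].
- have H0 : q k 0%N @[k --> U] --> gam 0.
    apply: q_at; rewrite maxxx.
    have -> : (fun k => 0%:R * tau k) = (fun=> 0) by apply: funext => k; rewrite mul0r.
    exact: cvg_cst.
  (* Two antiperiods, each of limit length [P]: the two changes of sign cancel. *)
  have H1 : q k (k.+2 + k.+2)%N @[k --> U] --> gam (2 * P).
    apply: q_at; rewrite max_l ?mulr_ge0 //.
    have -> : (fun k => (k.+2 + k.+2)%:R * tau k) = (fun k => 2 * (k.+2%:R * tau k)).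
      by apply: funext => k; rewrite natrD; ring.
    by apply: cvgM UP; exact: cvg_cst.
  apply: (norm_cvg_unique H0); apply: cvg_trans H1.
  apply: near_eq_cvg; apply: nearW => k.
  by rewrite anti -[X in q k X]add0n anti opprK.
- have H0 : q k 0%N @[k --> U] --> gam 0.
    apply: q_at; rewrite maxxx.
    have -> : (fun k => 0%:R * tau k) = (fun=> 0) by apply: funext => k; rewrite mul0r.
    exact: cvg_cst.
  have H1 : g (q k 0%N) @[k --> U] --> g (gam 0).
    apply: (@continuous_cvg _ _ _ U _ (fun k => q k 0%N) g (gam 0)) => //; exact: snorm_continuous gE _.
  apply/esym; apply: (norm_cvg_unique _ H1).
  have -> : (fun k => g (q k 0%N)) = (fun=> 1) by apply: funext => k; rewrite q0_1.
  exact: cvg_cst.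
Unshelve. all: by end_near. Qed.

End LimitOrbit.

(** * Norms with smooth unit balls *)

(** Convexity of the even power [2 (p + 1)]: its graph lies above the tangent at [a]. After division
    by [a] this is Bernoulli's inequality for [(1 + x) ^ 2 - 1], which is at least -1 for every real
    [x]. *)
Lemma tangent_le (R : realType) (p : nat) (a b : R) :
  (p.+1 * 2)%:R * (a ^+ (p * 2).+1 * b)
  <= (p * 2).+1%:R * a ^+ (p.+1 * 2) + b ^+ (p.+1 * 2).
Proof.
have bern (y : R) k : -1 <= y -> 1 + k%:R * y <= (1 + y) ^+ k.
  move=> y1; elim: k => [|k IH]; first by rewrite mul0r addr0 expr0.
  have y0 : 0 <= 1 + y by lra.
  have : (1 + y) * (1 + k%:R * y) <= (1 + y) * (1 + y) ^+ k by rewrite ler_wpM2l.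
  rewrite -exprS; apply: le_trans.
  have : 0 <= k%:R * y ^+ 2 by rewrite mulr_ge0 ?sqr_ge0.
  rewrite -[k.+1%:R]natr1; nra.
have E : (p.+1 * 2)%:R = (p * 2).+1%:R + 1 :> R by rewrite natr1.
have [->|a0] := eqVneq a 0.
  by rewrite !expr0n /= !(mul0r, mulr0) add0r exprM sqr_ge0.
pose x := b / a - 1.
have bx : b = a * (1 + x) by rewrite /x; field.
have y1 : -1 <= x *+ 2 + x ^+ 2 by have := sqr_ge0 (1 + x); rewrite sqrrD expr1n mul1r; lra.
have := bern _ p.+1 y1.
have -> : (1 + (x *+ 2 + x ^+ 2)) = (1 + x) ^+ 2 by ring.
rewrite -exprM mulnC => H.
have H1 : 1 + (p.+1 * 2)%:R * x <= (1 + x) ^+ (p.+1 * 2).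
  rewrite (le_trans _ H) // natrM.
  have : 0 <= p.+1%:R * x ^+ 2 by rewrite mulr_ge0 ?sqr_ge0.
  lra.
have as0 : 0 <= a ^+ (p.+1 * 2) by rewrite exprM sqr_ge0.
have := ler_wpM2l as0 H1; rewrite -exprMn -bx.
have -> : a ^+ (p * 2).+1 * b = a ^+ (p.+1 * 2) * (1 + x).
  by rewrite bx mulSn add2n [in RHS]exprSr; ring.
rewrite E; lra.
Qed.

Section PowerNorm.
Variables (R : realType) (n N p : nat).
Local Notation V := 'rV[R]_(n + n).
Variable l : 'I_N -> V.
Hypothesis l_total : forall x, (forall j, dot (l j) x = 0) -> x = 0.

Definition psum x : R := \sum_j dot (l j) x ^+ (p.+1 * 2).

Definition pgrad x : V := \sum_j dot (l j) x ^+ (p * 2).+1 *: l j.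

Definition pnorm x : R := psum x `^ ((p.+1 * 2)%:R^-1).

(** [J] times the gradient of [pnorm ^ 2 / 2]: differentiating [psum] to the power [2 / (2p + 2)]
    leaves the factor [pnorm] to the power [- 2p]. *)
Definition pfield x : V := (pnorm x)^-1 ^+ (p * 2) *: J (pgrad x).

Let s := (p.+1 * 2)%N.

Lemma even_powr_ge0 (a : R) : 0 <= a ^+ s.
Proof. by rewrite exprM sqr_ge0. Qed.

Lemma psum_ge0 x : 0 <= psum x.
Proof. by apply: sumr_ge0 => j _; exact: even_powr_ge0. Qed.

Lemma pnorm_ge0 x : 0 <= pnorm x. Proof. exact: powR_ge0. Qed.

Lemma pnormX x : pnorm x ^+ s = psum x.
Proof.
rewrite -powR_mulrn ?pnorm_ge0 // /pnorm -powRrM mulVf ?pnatr_eq0 //.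
by rewrite powRr1 // psum_ge0.
Qed.

Lemma pnorm_unique (a : R) x : 0 <= a -> a ^+ s = psum x -> pnorm x = a.
Proof.
move=> a0 ax; apply/eqP; rewrite -(eqrXn2 (_ : (0 < s)%N)) ?pnorm_ge0 //.
by rewrite pnormX ax.
Qed.

Lemma psumZ t x : psum (t *: x) = t ^+ s * psum x.
Proof.
by rewrite mulr_sumr; apply: eq_bigr => j _; rewrite dotZr exprMn.
Qed.

Lemma pnormZ t x : pnorm (t *: x) = `|t| * pnorm x.
Proof.
apply: pnorm_unique; first by rewrite mulr_ge0 ?pnorm_ge0.
rewrite exprMn pnormX psumZ; congr (_ * _).
by rewrite /s mulnC !exprM real_normK ?num_real.
Qed.

Lemma pnorm_gt0 x : x != 0 -> 0 < pnorm x.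
Proof.
move=> x0; rewrite lt_neqAle pnorm_ge0 andbT eq_sym; apply: contra x0 => /eqP g0.
have : psum x = 0 by rewrite -pnormX g0 expr0n.
move/eqP; rewrite psumr_eq0 => [/allP P0|j _]; last exact: even_powr_ge0.
apply/eqP/l_total => j; apply/eqP.
by have := P0 j (mem_index_enum _); rewrite /= expf_eq0 /=.
Qed.

Lemma pnorm0 : pnorm 0 = 0.
Proof. by have := pnormZ 0 0; rewrite scale0r normr0 mul0r. Qed.

Lemma dot_pgrad x : dot x (pgrad x) = psum x.
Proof.
rewrite dot_sumr; apply: eq_bigr => j _.
by rewrite dotZr dotC -exprSr /s mulSn add2n.
Qed.

Lemma pgradZ t x : pgrad (t *: x) = t ^+ (p * 2).+1 *: pgrad x.
Proof.
rewrite scaler_sumr; apply: eq_bigr => j _.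
by rewrite dotZr exprMn scalerA.
Qed.

(** Hölder's inequality, obtained for unit vectors by summing [tangent_le] over [j], then extended
    by homogeneity. *)
Lemma pgrad_le x y : dot y (pgrad x) <= pnorm x ^+ (p * 2).+1 * pnorm y.
Proof.
have unit_le u v : pnorm u = 1 -> pnorm v = 1 -> dot v (pgrad u) <= 1.
  move=> u1 v1; have s0 : 0 < (s%:R : R) by rewrite ltr0n.
  rewrite -(ler_pM2l s0) mulr1 dot_sumr mulr_sumr.
  have su : psum u = 1 by rewrite -pnormX u1 expr1n.
  have sv : psum v = 1 by rewrite -pnormX v1 expr1n.
  apply: (@le_trans _ _ ((p * 2).+1%:R * psum u + psum v)); last first.
    by rewrite su sv mulr1 natr1.
  rewrite mulr_sumr -big_split; apply: ler_sum => j _ /=.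
  by rewrite dotZr (dotC v); exact: tangent_le.
have [->|x0] := eqVneq x 0.
  by rewrite -{1}(scale0r x) pgradZ expr0n scale0r dot0r pnorm0 expr0n mul0r.
have [->|y0] := eqVneq y 0; first by rewrite dot0l pnorm0 mulr0.
have gx := pnorm_gt0 x0; have gy := pnorm_gt0 y0.
have nrm z : z != 0 -> pnorm ((pnorm z)^-1 *: z) = 1.
  move=> /pnorm_gt0 gz; rewrite pnormZ gtr0_norm ?invr_gt0 // mulVf //.
  by rewrite gt_eqF.
have := unit_le _ _ (nrm x x0) (nrm y y0).
rewrite pgradZ dotZl dotZr exprVn => H.
rewrite -ler_pdivrMl ?exprn_gt0 // -[leRHS]mulr1 -ler_pdivrMl //.
Qed.

Lemma is_derive_psum x y t :
  is_derive t (1 : R) (fun t : R => psum (x + t *: y))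
    (s%:R * dot y (pgrad (x + t *: y))).
Proof.
have -> : (fun t => psum (x + t *: y)) =
    \sum_j ((fun t : R => dot (l j) x + dot (l j) y * t) ^+ s).
  apply: funext => u; rewrite fct_sumE; apply: eq_bigr => j _.
  by rewrite fctE dotDr dotZr [u * _]mulrC.
have -> : s%:R * dot y (pgrad (x + t *: y)) =
    \sum_j (s%:R * (dot (l j) x + dot (l j) y * t) ^+ (p * 2).+1) *: dot (l j) y.
  rewrite dot_sumr mulr_sumr; apply: eq_bigr => j _.
  by rewrite dotZr dotDr dotZr (dotC y) [t * _]mulrC /GRing.scale /= mulrA.
apply: is_derive_sum => j.
have d : is_derive t (1 : R) (fun t : R => dot (l j) x + dot (l j) y * t) (dot (l j) y).
  by apply: is_derive_eq; rewrite /GRing.scale /=; ring.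
exact: (is_derive_eq (is_deriveX s d)).
Qed.

Lemma continuous_expn (T : topologicalType) (F : T -> R) (k : nat) :
  continuous F -> continuous (fun x => F x ^+ k).
Proof.
move=> Fc; elim: k => [|k IH].
  have -> : (fun x => F x ^+ 0) = cst 1 by [].
  by move=> ?; exact: cst_continuous.
have -> : (fun x => F x ^+ k.+1) = (fun x => F x * F x ^+ k).
  by apply: funext => x; rewrite exprS.
exact: continuous_mul.
Qed.

Lemma continuous_dotl (c : V) : continuous (dot c).
Proof. by apply: continuous_dot => [|x]; [exact: cst_continuous | exact: cvg_id]. Qed.

Lemma psum_continuous : continuous psum.
Proof.
apply: continuous_sum => j _; apply: continuous_expn.
exact: continuous_dotl.
Qed.

Lemma pgrad_continuous : continuous pgrad.
Proof.
apply: continuous_mx => i k.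
have -> : (fun x => pgrad x i k) = (fun x => \sum_j dot (l j) x ^+ (p * 2).+1 * l j i k).
  by apply: funext => x; rewrite summxE; apply: eq_bigr => j _; rewrite mxE.
apply: continuous_sum => j _; apply: continuous_mul; last by move=> ?; exact: cst_continuous.
by apply: continuous_expn; exact: continuous_dotl.
Qed.

(** Superadditivity of powers on nonnegative numbers. It makes [k]-th roots continuous, at 0
    included, hence [pnorm] as well. *)
Lemma expr_dist (a b : R) k : (0 < k)%N -> 0 <= a -> 0 <= b ->
  `|a - b| ^+ k <= `|a ^+ k - b ^+ k|.
Proof.
move=> k0 a0 b0; wlog ab : a b a0 b0 / b <= a.
  move=> H; have [ba|/ltW ab] := leP b a; first exact: H.
  by rewrite (distrC a) (distrC (a ^+ k)); exact: H.
have d0 : 0 <= a - b by rewrite subr_ge0.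
have H : b ^+ k + (a - b) ^+ k <= a ^+ k.
  case: k k0 => // k _; elim: k => [|k IH]; first by rewrite !expr1 subrKC.
  have -> : a ^+ k.+2 = b * a ^+ k.+1 + (a - b) * a ^+ k.+1 by rewrite exprS; ring.
  rewrite exprS [(a - b) ^+ _]exprS lerD // ler_wpM2l //.
    by rewrite (le_trans _ IH) // lerDl exprn_ge0.
  by rewrite (le_trans _ IH) // lerDr exprn_ge0.
rewrite (ger0_norm d0); apply: le_trans (ler_norm _); lra.
Qed.

Lemma continuous_expn_inv (T : topologicalType) (F : T -> R) k : (0 < k)%N ->
  (forall x, 0 <= F x) -> continuous (fun x => F x ^+ k) -> continuous F.
Proof.
move=> k0 F0 Fc x; apply/cvgrPdist_lt => e e0.
have : F y ^+ k @[y --> x] --> F x ^+ k by exact: Fc.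
move=> /cvgrPdist_lt/(_ (e ^+ k)); rewrite exprn_gt0 // => /(_ isT).
apply: filterS => y H; rewrite -(ltr_pXn2r k0) ?nnegrE ?(ltW e0) //.
by rewrite (le_lt_trans (expr_dist k0 (F0 _) (F0 _))).
Qed.

Lemma pnorm_continuous : continuous pnorm.
Proof.
apply: (@continuous_expn_inv _ _ s) => //; first exact: pnorm_ge0.
rewrite (_ : (fun _ => _) = psum); first exact: psum_continuous.
by apply: funext => x; exact: pnormX.
Qed.

Lemma omega_pfield y x :
  omega y (pfield x) = (pnorm x)^-1 ^+ (p * 2) * dot y (pgrad x).
Proof. by rewrite omegaZr /omega dotJJ. Qed.

Lemma pfield0 : pfield 0 = 0.
Proof.
by rewrite /pfield -{2}(scale0r (0 : V)) pgradZ expr0n scale0r J0 scaler0.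
Qed.

Lemma omega_pfield_le x y : omega y (pfield x) <= pnorm x * pnorm y.
Proof.
have [->|x0] := eqVneq x 0; first by rewrite pfield0 omega0r pnorm0 mul0r.
have gx := pnorm_gt0 x0.
rewrite omega_pfield exprVn ler_pdivrMl ?exprn_gt0 //.
by rewrite mulrA -exprSr pgrad_le.
Qed.

Lemma pnorm_sqrE x : pnorm x ^+ 2 = psum x `^ (p.+1%:R^-1).
Proof.
rewrite -powR_mulrn ?pnorm_ge0 // /pnorm -powRrM; congr (_ `^ _).
by rewrite natrM; field; rewrite ?natr1 ?nat1r pnatr_eq0.
Qed.

Lemma is_derive_pnorm_sqr x y t :
  is_derive t (1 : R) (fun t : R => pnorm (x + t *: y) ^+ 2)
    (2 * omega y (pfield (x + t *: y))).
Proof.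
have [z0|z0] := eqVneq (x + t *: y) 0.
  (* The real power is singular at 0, but here the line passes through the origin and [pnorm ^ 2] is
     exactly quadratic along it. *)
  have -> : (fun t : R => pnorm (x + t *: y) ^+ 2) =
      (fun u => pnorm y ^+ 2 * (u - t) ^+ 2).
    apply: funext => u.
    have -> : x + u *: y = (u - t) *: y.
      by rewrite scalerBl -[x](addrK (t *: y)) z0 sub0r addrC.
    by rewrite pnormZ exprMn real_normK ?num_real // mulrC.
  rewrite z0 pfield0 omega0r mulr0.
  by apply: is_derive_eq; rewrite /GRing.scale /=; ring.
have gz := pnorm_gt0 z0.
have Fz : 0 < psum (x + t *: y) by rewrite -pnormX exprn_gt0.
have -> : (fun t : R => pnorm (x + t *: y) ^+ 2) =
  (@powR R ^~ (p.+1%:R^-1)) \o (fun t => psum (x + t *: y)).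
  by apply: funext => u /=; exact: pnorm_sqrE.
apply: is_derive_eq.
  apply: is_derive1_comp; last exact: is_derive_psum.
  exact: is_derive1_powR.
rewrite omega_pfield; set z := x + t *: y.
have -> : psum z `^ (p.+1%:R^-1 - 1) = (pnorm z)^-1 ^+ (p * 2).
  rewrite -pnormX -powR_mulrn ?pnorm_ge0 // -powRrM.
  have -> : s%:R * (p.+1%:R^-1 - 1) = - (p * 2)%:R :> R.
    by rewrite /s !natrM -natr1; field; rewrite ?natr1 ?nat1r pnatr_eq0.
  by rewrite powRN powR_mulrn ?pnorm_ge0 // exprVn.
rewrite /s natrM; field; rewrite ?natr1 ?nat1r pnatr_eq0 //.
Qed.

Lemma pfieldZ t x : pfield (t *: x) = t *: pfield x.
Proof.
have [->|t0] := eqVneq t 0; first by rewrite !scale0r pfield0.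
rewrite /pfield pnormZ pgradZ JZ !scalerA; congr (_ *: _).
rewrite invfM exprMn.
have -> : `|t|^-1 ^+ (p * 2) = t^-1 ^+ (p * 2).
  by rewrite mulnC !exprM !exprVn real_normK ?num_real.
by rewrite exprS exprVn; field; rewrite expf_neq0.
Qed.

Lemma pfield_continuous : continuous pfield.
Proof.
apply: continuous_mx => i k; rewrite [i]ord1 => x.
have [->|x0] := eqVneq x 0.
  (* At the origin the quotient formula breaks down; each entry of [pfield] is a symplectic product
     with a basis vector, which [omega_pfield_le] bounds by a multiple of [pnorm]. *)
  apply: (@continuous_dominated_at _ _ _
    (fun y => pnorm y * pnorm (J (delta_mx 0 k)))).
  - apply: continuous_mul; first exact: pnorm_continuous.
    by move=> ?; exact: cst_continuous.
  - by rewrite pnorm0 mul0r.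
  - move=> y; rewrite pfield0 mxE sub0r normrN.
    have E : pfield y 0 k = omega (- J (delta_mx 0 k)) (pfield y).
      by rewrite /omega JN JJ opprK dot_delta.
    have gN z : pnorm (- z) = pnorm z by rewrite -scaleN1r pnormZ normrN1 mul1r.
    rewrite E ler_norml; apply/andP; split.
      by rewrite lerNl -omegaNl opprK omega_pfield_le.
    by rewrite -[X in _ <= _ * X]gN omega_pfield_le.
have -> : (fun y => pfield y 0 k) = (fun y => (pnorm y ^+ (p * 2))^-1 * J (pgrad y) 0 k).
  by apply: funext => y; rewrite mxE exprVn.
apply: (@continuousM R _ (fun y => (pnorm y ^+ (p * 2))^-1) (fun y => J (pgrad y) 0 k)).
  apply: (@continuousV R _ (fun y => pnorm y ^+ (p * 2))).
    by rewrite expf_neq0 // gt_eqF // pnorm_gt0.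
  by apply: continuous_expn; exact: pnorm_continuous.
by apply: continuous_entry; apply: continuous_J; exact: pgrad_continuous.
Qed.

Lemma pnorm_smooth_norm : smooth_norm pnorm pfield.
Proof.
split.
- exact: pnorm_continuous.
- exact: pnorm_gt0.
- exact: pnormZ.
- move=> x; have [->|x0] := eqVneq x 0.
    by rewrite omega0l pnorm0 expr0n.
  rewrite omega_pfield dot_pgrad -pnormX /s mulSn addnC exprD exprVn mulrA mulVf ?mul1r //.
  by rewrite expf_neq0 // gt_eqF // pnorm_gt0.
- exact: omega_pfield_le.
- exact: is_derive_pnorm_sqr.
- exact: pfield_continuous.
- exact: pfieldZ.
Qed.

Lemma is_derive_entry (gamma : R -> V) (v : V) (t : R) k :
  is_derive t (1 : R) gamma v -> is_derive t (1 : R) (fun u => gamma u 0 k) (v 0 k).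
Proof.
move=> gv; have d := @ex_derive _ _ _ _ _ _ _ gv.
have dk : derivable (fun u => gamma u 0 k) t 1 by move/derivable_mxP : d; exact.
apply: DeriveDef => //.
by rewrite -(@derive_val _ _ _ _ _ _ _ gv) derive_mx // mxE.
Qed.

(* The derivative is a multiple of [omega v v]. *)
Lemma psum_conserved (gamma : R -> V) (t : R) :
  is_derive t (1 : R) gamma (pfield (gamma t)) ->
  is_derive t (1 : R) (psum \o gamma) 0.
Proof.
move=> gv; set v := pfield (gamma t).
have -> : psum \o gamma =
    \sum_j ((\sum_k (fun u : R => l j 0 k * gamma u 0 k)) ^+ s).
  apply: funext => u; rewrite fct_sumE; apply: eq_bigr => j _.
  by rewrite fctE fct_sumE.
have -> : 0 = \sum_j (s%:R * dot (l j) (gamma t) ^+ (p * 2).+1) *: dot (l j) v.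
  have : dot (pgrad (gamma t)) v = 0.
    by rewrite /v /pfield dotZr dotJ -omegaE omegaxx oppr0 mulr0.
  rewrite dot_suml => /(congr1 ( *%R s%:R)); rewrite mulr0 => H; apply: (etrans (esym H)).
  by rewrite mulr_sumr; apply: eq_bigr => j _; rewrite dotZl mulrA.
apply: is_derive_sum => j.
have d : is_derive t (1 : R) (\sum_k (fun u : R => l j 0 k * gamma u 0 k)) (dot (l j) v).
  by apply: is_derive_sum => k; apply: is_deriveZ; exact: is_derive_entry gv.
by apply: (is_derive_eq (is_deriveX s d)); rewrite fct_sumE.
Qed.

End PowerNorm.

(** * Gauge, boundary and action on a smooth unit ball *)

Lemma convex_setE (R : realType) (m : nat) (X : set 'rV[R]_m) :
  convex_set (X : set (convex_lmodType 'rV[R]_m)) <->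
  forall x y t, X x -> X y -> 0 <= t <= 1 -> X (t *: x + (1 - t) *: y).
Proof.
split=> [cX x y t Xx Xy /andP[t0 t1]|cX x y t].
  have := cX x y (Itv01 t0 t1); rewrite !inE => /(_ Xx Xy).
  exact.
rewrite !inE => Xx Xy; apply: (cX x y t%:num) => //.
by apply/andP; split.
Qed.

Section UnitBall.
Variables (R : realType) (n : nat).
Local Notation V := 'rV[R]_(n + n).
Variables (g : V -> R) (E : V -> V).
Hypothesis gE : smooth_norm g E.

Let Z : set V := [set x | g x <= 1].

(** The vector [E (x + y)] norms [x + y]: the square of [g (x + y)] is [omega (x + y) (E (x + y))],
    whose two terms are bounded separately. *)
Lemma snorm_triangle x y : g (x + y) <= g x + g y.
Proof.
have [->|xy0] := eqVneq (x + y) 0.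
  by rewrite (snorm0 gE) addr_ge0 ?(snorm_ge0 gE).
have gxy := snorm_gt0 gE xy0.
rewrite -(ler_pM2l gxy) -expr2 -(omega_field gE) omegaDl mulrDr.
by rewrite lerD // (omega_field_le gE).
Qed.

Lemma ball_closed : closed Z.
Proof.
apply: (@closed_comp _ _ g [set r | r <= 1]); last exact: closed_le.
by move=> x _; exact: snorm_continuous gE _.
Qed.

Lemma ball_compact : compact Z.
Proof.
have [C H] : exists C, forall x, Z x -> `|x| <= C.
  case: (posnP n) => [n0|n_gt0].
    exists 0 => x _; rewrite (_ : x = 0) ?normr0 //.
    by apply/rowP => i; exfalso; have := ltn_ord i; move: (nat_of_ord i) => k; rewrite n0.
  have [C C0 gC] := snorm_coercive gE n_gt0; exists C => x Zx.
  by rewrite (le_trans (gC x)) // -[leRHS]mulr1 ler_pM2l.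
exact: mx_bounded_closed_compact H ball_closed.
Qed.

Lemma ball_interior : interior Z = [set x | g x < 1].
Proof.
apply/seteqP; split => [x Zx|].
  rewrite /= lt_neqAle; have := interior_subset Zx; rewrite /Z /= => ->.
  rewrite andbT; apply/negP => /eqP gx1.
  have cs : {for (1 : R), continuous (fun t : R => t *: x)}.
    by apply: cvgZr_tmp; exact: cvg_id.
  have : \forall t \near (1 : R), Z (t *: x).
    by apply: cs; rewrite scale1r; exact: Zx.
  move=> /nbhs_ballP[e /= e0 eZ].
  have e2 : 0 < e / 2 by rewrite divr_gt0.
  have b : ball (1 : R) e (1 + e / 2).
    rewrite -ball_normE /= opprD addrA subrr sub0r normrN gtr0_norm //.
    by rewrite ltr_pdivrMr // ltr_pMr // ltr1n.
  have := eZ _ b; rewrite /Z /= (snormZ gE) gx1 mulr1 gtr0_norm ?addr_gt0 //.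
  lra.
rewrite -open_subsetE; first by move=> x /= /ltW.
apply: (@open_comp _ _ g [set r | r < 1]); last exact: open_lt.
by move=> x _; exact: snorm_continuous gE _.
Qed.

Lemma ball_boundary : boundary Z = [set x | g x = 1].
Proof.
rewrite /boundary ball_interior -(closure_id Z).1; last exact: ball_closed.
apply/seteqP; split => [x [/= gx /negP]|x /= gx].
  by rewrite -leNgt => gx'; apply/eqP; rewrite eq_le gx gx'.
by rewrite /Z /= gx lexx ltxx.
Qed.

Lemma ball_convex_body : convex_body Z.
Proof.
split; first exact: ball_compact.
  apply/convex_setE => x y t Zx Zy /andP[t0 t1].
  rewrite /Z /= (le_trans (snorm_triangle _ _)) // !(snormZ gE).
  rewrite !ger0_norm ?subr_ge0 //.
  have : t * g x <= t * 1 by rewrite ler_wpM2l.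
  have : (1 - t) * g y <= (1 - t) * 1 by rewrite ler_wpM2l // subr_ge0.
  lra.
by exists 0; rewrite ball_interior /= (snorm0 gE).
Qed.

Lemma ball_gauge : gauge_fun Z = g.
Proof.
apply: funext => x; rewrite /gauge_fun.
have -> : [set t : R | 0 < t /\ Z (t^-1 *: x)] = [set t | 0 < t /\ g x <= t].
  apply/seteqP; split => t /= [t0 H]; split => //; move: H;
  by rewrite /Z /= (snormZ gE) gtr0_norm ?invr_gt0 // mulrC ler_pdivrMr // mul1r.
have lb : lbound [set t : R | 0 < t /\ g x <= t] (g x) by move=> t [].
apply/eqP; rewrite eq_le; apply/andP; split; last first.
  apply: lb_le_inf => //; exists (g x + 1) => /=.
  by rewrite ltr_wpDl ?(snorm_ge0 gE) // lerDl.
apply/ler_addgt0Pr => e e0; apply: ge_inf; first by exists (g x).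
by rewrite /= ltr_wpDl ?(snorm_ge0 gE) // lerDl ltW.
Qed.

Lemma is_derive_line (f : V -> R) (x v : V) (d : R) :
  is_derive (0 : R) (1 : R) (fun t : R => f (x + t *: v)) d -> 'D_v f x = d.
Proof.
move=> fd; rewrite -(@derive_val _ _ _ _ _ _ _ fd) /derive.
suff -> : (fun h : R => h^-1 *: ((f \o shift x) (h *: v) - f x)) =
    (fun h : R => h^-1 *: (((fun t => f (x + t *: v)) \o shift 0) (h *: 1)
                           - f (x + 0 *: v))) by [].
apply: funext => h /=.
by rewrite addr0 scale0r addr0 [h *: 1]mulr1 [h *: v + x]addrC.
Qed.

(** Where [g = 1], the functions [g] and [g ^ 2 / 2] have the same gradient. *)
Lemma J_gradient_ball x : g x = 1 -> J (gradient (gauge_fun Z) x) = E x.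
Proof.
move=> gx; rewrite ball_gauge.
have -> : gradient g x = - J (E x).
  apply/rowP => i; rewrite mxE -[RHS]dot_delta dotNr dotJ opprK -omegaE.
  apply: is_derive_line; set v := delta_mx 0 i.
  have d := is_derive_snorm_sqr gE x v 0.
  have g0 : 0 < g (x + 0 *: v) ^+ 2 by rewrite scale0r addr0 gx expr1n.
  have -> : (fun t : R => g (x + t *: v)) =
      Num.sqrt \o (fun t : R => g (x + t *: v) ^+ 2).
    by apply: funext => t /=; rewrite sqrtr_sqr ger0_norm // (snorm_ge0 gE).
  apply: is_derive_eq; first apply: is_derive1_comp.
    exact: is_derive1_sqrt.
  by rewrite scale0r addr0 gx expr1n sqrtr1; field.
by rewrite JN JJ opprK.
Qed.

(** Euler's identity makes the integrand [omega x (E x) = g x ^ 2 = 1]. The equation of motion holds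
    in the open interval, whose endpoints are negligible. *)
Lemma ball_action T gamma :
  closed_characteristic Z T gamma -> action T gamma = T / 2.
Proof.
move=> [T0 _ _ bd d]; rewrite /action mulrC; congr (_ / _).
have H t : t \in `]0, T[%R -> omega (gamma t) (derive1 gamma t) = 1.
  move=> t0T; have := d t t0T => dt.
  have gt : g (gamma t) = 1.
    have := bd t; rewrite ball_boundary; apply.
    by move: t0T; rewrite !in_itv /= => /andP[/ltW -> /ltW ->].
  rewrite derive1E (@derive_val _ _ _ _ _ _ _ dt) J_gradient_ball //.
  by rewrite (omega_field gE) gt expr1n.
rewrite /Rintegral integral_itv_bndoo.
  rewrite (@eq_integral _ _ _ _ _ (cst 1%:E)) => [|t]; last first.
    by rewrite inE /= => t0T; rewrite H.
  rewrite integral_cst //= mul1e.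
  by rewrite lebesgue_measure_itv /= lte_fin T0 /= subr0.
apply: (eq_measurable_fun (cst (1 : R)%:E)) => [t|]; last exact: measurable_cst.
by rewrite inE /= => t0T; rewrite H.
Qed.

End UnitBall.

(** * Closed characteristics *)

Section PowerBall.
Variables (R : realType) (n N p : nat).
Local Notation V := 'rV[R]_(n + n).
Variable l : 'I_N -> V.
Hypothesis l_total : forall x, (forall j, dot (l j) x = 0) -> x = 0.

Local Notation g := (pnorm p l).
Let gE := pnorm_smooth_norm p l_total.
Let Z : set V := [set x | g x <= 1].

(** A family that contains [psum - 1] and is closed under directional derivatives, as the iterated
    derivatives in [smooth_on] call for. *)
Let polyf (c0 : R) (c : 'I_N -> R) (k : nat) (x : V) : R :=
  c0 + \sum_j c j * dot (l j) x ^+ k.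

Let polyf_differentiable c0 c k x : differentiable (polyf c0 c k) x.
Proof.
have dl j : differentiable (dot (l j)) x.
  have -> : dot (l j) = \sum_i (l j 0 i *: (fun x : V => x 0 i)).
    by apply: funext => y; rewrite fct_sumE.
  apply: differentiable_sum => i; apply: differentiableZ.
  exact: differentiable_coord.
have -> : polyf c0 c k = cst c0 + \sum_j (c j *: (dot (l j) ^+ k)).
  apply: funext => y; rewrite fctE fct_sumE; congr (_ + _).
  by apply: eq_bigr => j _; rewrite fctE.
apply: differentiableD; first exact: differentiable_cst.
apply: differentiable_sum => j; apply: differentiableZ.
case: k => [|k]; first by rewrite expr0; exact: differentiable_cst.
exact: differentiableX.
Qed.

Let polyf_derive c0 c k v :
  'D_v (polyf c0 c k) = polyf 0 (fun j => c j * k%:R * dot (l j) v) k.-1.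
Proof.
apply: funext => x; apply: is_derive_line.
have -> : (fun t => polyf c0 c k (x + t *: v)) =
    cst c0 + \sum_j (c j *: (fun t : R => dot (l j) x + dot (l j) v * t) ^+ k).
  apply: funext => u; rewrite fctE fct_sumE; congr (_ + _).
  by apply: eq_bigr => j _; rewrite !fctE dotDr dotZr [u * _]mulrC.
rewrite /polyf; apply: is_deriveD; apply: is_derive_sum => j.
have d : is_derive (0 : R) (1 : R) (fun t : R => dot (l j) x + dot (l j) v * t)
    (dot (l j) v).
  by apply: is_derive_eq; rewrite /GRing.scale /=; ring.
apply: (is_derive_eq (is_deriveZ (c j) (is_deriveX k d))).
by rewrite mulr0 addr0 /GRing.scale /=; ring.
Qed.

Lemma psum_smooth (U : set V) : smooth_on U (fun x => psum p l x - 1).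
Proof.
move=> vs x _.
suff [c0 [c [k ->]]] : exists c0 c k,
    foldr (fun v (f : V -> R) => 'D_v f) (fun x => psum p l x - 1) vs = polyf c0 c k.
  exact: polyf_differentiable.
elim: vs => [|v vs [c0 [c [k /= ->]]]].
  exists (-1), (fun=> 1), (p.+1 * 2)%N; apply: funext => y /=.
  rewrite /polyf addrC; congr (_ + _); apply: eq_bigr => j _.
  by rewrite mul1r.
by rewrite polyf_derive; do 3 eexists.
Qed.

Lemma pball_smooth_body : smooth_body Z.
Proof.
split; [exact: ball_convex_body gE| |by rewrite (ball_interior gE) /= pnorm0].
move=> x; rewrite (ball_boundary gE) /= => gx.
exists setT, (fun x => psum p l x - 1); split => //.
- exact: openT.
- exact: psum_smooth.
- have D v : 'D_v (fun x => psum p l x - 1) x = (p.+1 * 2)%:R * dot v (pgrad p l x).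
    apply: is_derive_line.
    have d := is_deriveB (is_derive_psum p l x v 0) (is_derive_cst (1 : R) (0 : R) (1 : R)).
    by apply: (is_derive_eq d); rewrite scale0r addr0 subr0.
  have -> : gradient (fun x => psum p l x - 1) x = (p.+1 * 2)%:R *: pgrad p l x.
    by apply/rowP => i; rewrite mxE D mxE dot_delta.
  (* By Euler's identity the gradient pairs with [x] to [2 (p + 1)], so it cannot vanish. *)
  move=> /(congr1 (dot x)); rewrite dotZr dot_pgrad -pnormX gx expr1n mulr1 dot0r.
  by move/eqP; rewrite pnatr_eq0.
- rewrite !setIT; apply/seteqP; split => y /=.
    by move=> gy; rewrite -pnormX gy expr1n subrr.
  move/eqP; rewrite subr_eq0 => /eqP py; apply: pnorm_unique => //.
  by rewrite py expr1n.
Qed.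

Lemma closed_characteristic_of_orbit (gamma : R -> V) (P : R) : 0 < P ->
  continuous gamma -> gamma 0 = gamma (2 * P) -> g (gamma 0) = 1 ->
  (forall t : R, 0 < t -> is_derive t (1 : R) gamma (pfield p l (gamma t))) ->
  closed_characteristic Z (2 * P) gamma.
Proof.
move=> P0 gc gcl g1 gd.
have pc : continuous (psum p l \o gamma).
  move=> t; apply: (@continuous_comp _ _ _ gamma (psum p l)); first exact: gc.
  exact: psum_continuous.
(* Energy conservation and the mean value theorem keep the limit curve on the boundary; the polygons
   gave [g = 1] at time 0 only. *)
have gg t : 0 <= t -> g (gamma t) = 1.
  move=> t0; apply: pnorm_unique => //; rewrite expr1n.
  have <- : psum p l (gamma 0) = 1 by rewrite -pnormX g1 expr1n.
  have [|c _] := @MVT_segment R (psum p l \o gamma) (fun=> 0) 0 t t0 _ (continuous_subspaceT pc).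
    move=> x; rewrite in_itv /= => /andP[x0 _]; apply: psum_conserved => //.
    exact: gd.
  by rewrite mul0r /= => /eqP; rewrite subr_eq0 => /eqP ->.
split => //; first by rewrite mulr_gt0.
- exact: continuous_subspaceT.
- move=> t; rewrite in_itv /= => /andP[t0 _].
  by rewrite (ball_boundary gE) /= gg.
- move=> t; rewrite in_itv /= => /andP[t0 _].
  by rewrite (J_gradient_ball gE) ?gg ?ltW //; exact: gd.
Qed.

(** When the set of actions has no minimum, the default value 0 lies within both bounds. *)
Lemma min_action_le (gamma : R -> V) (P : R) : 0 < P ->
  closed_characteristic Z (2 * P) gamma -> 0 <= min_action Z <= P.
Proof.
move=> P0 cg; rewrite /min_action; case: xgetP => [a -> [Ha lb]|_]; last by rewrite lexx ltW.
case: Ha lb => T [gam [cgam ->]] lb; apply/andP; split.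
  rewrite (ball_action gE cgam) divr_ge0 //.
  by case: cgam => /ltW.
apply: lb; exists (2 * P), gamma; split => //.
by rewrite (ball_action gE cg); field.
Qed.

(** In dimension 0 the boundary is empty, so there is no closed characteristic and the default value
    appears. *)
Lemma min_action_dim0 : n = 0%N -> min_action Z = 0.
Proof.
move=> n0; rewrite /min_action; apply: xgetPN => a [[T [gam [cgam _]]] _].
case: cgam => T0 _ _ /(_ 0); rewrite in_itv /= lexx ltW // => /(_ isT) + _.
rewrite (ball_boundary gE) /= (_ : gam 0 = 0) ?pnorm0 // => [/esym/eqP|].
  by rewrite oner_eq0.
by apply/rowP => i; exfalso; have := ltn_ord i; move: (nat_of_ord i) => k; rewrite n0.
Qed.

End PowerBall.

(** * The constant pi and the bound for a pair of smooth balls *)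

Lemma cvg_cot_pi (R : realType) :
  (2 * k.+2%:R / ct R k.+2 0) @[k --> \oo] --> (pi : R).
Proof.
pose h (k : nat) : R := pi / (2 * k.+2%:R).
have h0 k : 0 < h k by rewrite divr_gt0 ?pi_gt0 ?mulr_gt0.
have hc : h k @[k --> \oo] --> (0 : R).
  have H : k.+2%:R^-1 @[k --> \oo] --> (0 : R).
    apply: (squeeze_cvgr _ (cvg_cst 0) (@cvg_harmonic R)); apply: nearW => k /=.
    by rewrite invr_ge0 ler0n /= lef_pV2 ?posrE // ler_nat.
  have -> : h = (fun k => pi / 2 * k.+2%:R^-1).
    by apply: funext => k; rewrite /h invfM mulrA.
  by rewrite -(mulr0 (pi / 2)); apply: cvgM; [exact: cvg_cst | exact: H].
have hc' : h k @[k --> \oo] --> (0 : R)^'.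
  move=> A HA; have : \forall k \near \oo, h k != 0 -> A (h k) := hc _ HA.
  by apply: filterS => k; apply; rewrite gt_eqF.
have sc : sin (h k) / h k @[k --> \oo] --> (1 : R).
  have d := is_derive_sin (0 : R); rewrite cos0 in d.
  have D : h^-1 *: ((sin \o shift 0) (h *: 1) - sin 0) @[h --> (0 : R)^']
      --> ('D_1 sin (0 : R) : R).
    exact: (@ex_derive _ _ _ _ _ _ _ d).
  rewrite (@derive_val _ _ _ _ _ _ _ d) in D.
  have := cvg_comp _ _ hc' D; apply: cvg_trans; apply: near_eq_cvg.
  apply: nearW => k /=.
  by rewrite sin0 subr0 addr0 [h k *: 1]mulr1 /GRing.scale /= mulrC.
have cc : cos (h k) @[k --> \oo] --> (1 : R).
  rewrite -(@cos0 R); apply: (@continuous_cvg _ _ _ _ _ h (@cos R) 0) => //.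
  exact: continuous_cos.
have : pi * ((sin (h k) / h k) / cos (h k)) @[k --> \oo] --> (pi * (1 / 1) : R).
  apply: cvgM; first exact: cvg_cst.
  apply: cvgM => //; apply: cvgV => //; exact: oner_neq0.
rewrite divr1 mulr1; apply: cvg_trans; apply: near_eq_cvg; apply: nearW => k /=.
have th : theta R k.+2 0 / 2 = h k.
  by rewrite /theta double0 mulr1 /h invfM mulrA mulrAC.
rewrite /ct th [in RHS]invf_div; move: (sin (h k)) (cos (h k))^-1 => S C.
have pn : (pi : R) != 0 by rewrite gt_eqF // pi_gt0.
have kn : (k.+2%:R : R) != 0 by rewrite pnatr_eq0.
rewrite /h; move: (pi : R) pn (k.+2%:R) kn => q qn a an; field.
by rewrite an qn.
Qed.

Lemma ultra_cvg_bounded (R : realType) (U : set_system nat) (f : nat -> R) (B : R) :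
  UltraFilter U -> (\forall k \near U, 0 <= f k <= B) ->
  exists P : R, f k @[k --> U] --> P.
Proof.
move=> UU fB; have := @segment_compact R 0 B; rewrite compact_ultra.
move=> /(_ (f @ U) (ultra_fmap f UU)); case=> [|P [_ fP]]; last by exists P.
have : \forall k \near U, `[0, B]%classic (f k).
  by apply: filterS fB => k; rewrite /= in_itv.
exact.
Qed.

(** The hypothesis that the two balls pair to at most 1 is inherited by subsets: it holds for inner
    approximations of a body and of its polar that are chosen independently. *)
Lemma pair_min_action (R : realType) (n N1 N2 p1 p2 : nat)
    (l1 : 'I_N1 -> 'rV[R]_(n + n)) (l2 : 'I_N2 -> 'rV[R]_(n + n)) :
  let Z1 := [set x | pnorm p1 l1 x <= 1] in
  let Z2 := [set x | pnorm p2 l2 x <= 1] in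
  (forall x, (forall j, dot (l1 j) x = 0) -> x = 0) ->
  (forall x, (forall j, dot (l2 j) x = 0) -> x = 0) ->
  (forall x y, Z1 x -> Z2 y -> omega x y <= 1) ->
  [/\ 0 <= min_action Z1, 0 <= min_action Z2 &
      min_action Z1 * min_action Z2 <= pi ^+ 2].
Proof.
move=> Z1 Z2 tot1 tot2 Z12.
case: (posnP n) => [n0|n_gt0].
  rewrite /Z1 /Z2 (min_action_dim0 _ tot1 n0) (min_action_dim0 _ tot2 n0) mulr0.
  by rewrite lexx sqr_ge0.
have gE1 := pnorm_smooth_norm p1 tot1; have gE2 := pnorm_smooth_norm p2 tot2.
set g1 := pnorm p1 l1 in gE1; set g2 := pnorm p2 l2 in gE2.
have polar x y : omega y x <= g1 x * g2 y.
  have [->|x0] := eqVneq x 0; first by rewrite omega0r (snorm0 gE1) mul0r.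
  have [->|y0] := eqVneq y 0; first by rewrite omega0l (snorm0 gE2) mulr0.
  have gx := snorm_gt0 gE1 x0; have gy := snorm_gt0 gE2 y0.
  have unit (g : 'rV[R]_(n + n) -> R) E (gE : smooth_norm g E) z :
      0 < g z -> g ((g z)^-1 *: z) <= 1.
    by move=> gz; rewrite (snormZ gE) gtr0_norm ?invr_gt0 // mulVf // gt_eqF.
  have := Z12 (- ((g1 x)^-1 *: x)) ((g2 y)^-1 *: y).
  rewrite /Z1 /Z2 /= -/g1 -/g2 (snormN gE1) => /(_ (unit _ _ gE1 _ gx) (unit _ _ gE2 _ gy)).
  by rewrite omegaNl -omegaC omegaZl omegaZr ler_pdivrMl // mulr1 ler_pdivrMl.
pose D (g : 'rV[R]_(n + n) -> R) E k (w : R * (nat -> 'rV[R]_(n + n))) := [/\ 0 < w.1,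
    forall u : 'I_k.+2 -> 'rV[R]_(n + n), act u <= w.1 * \sum_i dnorm g (u i) ^+ 2,
    forall i, w.2 i.+1 - w.2 i = w.1^-1 *: (E (w.2 i) + E (w.2 i.+1))
  & [/\ forall i, w.2 (i + k.+2)%N = - w.2 i, forall i, g (w.2 i) <= 1
      & g (w.2 0%N) = 1]].
have Dex (g : 'rV[R]_(n + n) -> R) E (gE : smooth_norm g E) k : exists w, D g E k w.
  by have [mu [q H]] := discrete_orbit gE n_gt0 (isT : 1 < k.+2)%N; exists (mu, q).
have [w1 Dw1] := choice (Dex _ _ gE1); have [w2 Dw2] := choice (Dex _ _ gE2).
(* The scheme reads [mu^-1 *: (E + E)], and a trapezoidal step of length [tau] has the factor
   [tau / 2]. *)
pose tau (w : nat -> R * (nat -> 'rV[R]_(n + n))) k := 2 / (w k).1.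
have tau_gt0 (g : 'rV[R]_(n + n) -> R) E w :
    (forall k, D g E k (w k)) -> forall k, 0 < tau w k.
  by move=> Dw k; rewrite divr_gt0 //; case: (Dw k).
have tau_step g E w : (forall k, D g E k (w k)) -> forall k i,
    (w k).2 i.+1 - (w k).2 i = (tau w k / 2) *: (E ((w k).2 i) + E ((w k).2 i.+1)).
  by move=> Dw k i; case: (Dw k) => w0 _ -> _; rewrite /tau mulrAC divff // mul1r.
have tau_anti g E w : (forall k, D g E k (w k)) ->
    forall k i, (w k).2 (i + k.+2)%N = - (w k).2 i.
  by move=> Dw k; case: (Dw k) => _ _ _ [].
have tau_le1 g E w : (forall k, D g E k (w k)) -> forall k i, g ((w k).2 i) <= 1.
  by move=> Dw k; case: (Dw k) => _ _ _ [].
have tau_01 g E w : (forall k, D g E k (w k)) -> forall k, g ((w k).2 0%N) = 1.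
  by move=> Dw k; case: (Dw k) => _ _ _ [].
have lim_action (g : 'rV[R]_(n + n) -> R) E (gE : smooth_norm g E) w U (P : R) :
    (forall k, D g E k (w k)) ->
    UltraFilter U -> U --> \oo -> k.+2%:R * tau w k @[k --> U] --> P ->
    exists gamma : R -> 'rV[R]_(n + n),
    [/\ continuous gamma, gamma 0 = gamma (2 * P), g (gamma 0) = 1
      & forall t : R, 0 < t -> is_derive t 1 gamma (E (gamma t))].
  move=> Dw UU Uoo UP.
  exact: (limit_orbit gE n_gt0 (tau_gt0 _ _ _ Dw) (tau_step _ _ _ Dw)
    (tau_anti _ _ _ Dw) (tau_le1 _ _ _ Dw) (tau_01 _ _ _ Dw) UU Uoo UP).
have per (g : 'rV[R]_(n + n) -> R) E (gE : smooth_norm g E) w :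
    (forall k, D g E k (w k)) ->
    exists2 c : R, 0 < c & forall k, c <= k.+2%:R * tau w k.
  move=> Dw; exact: (period_ge gE n_gt0 (tau_gt0 _ _ _ Dw) (tau_step _ _ _ Dw)
    (tau_anti _ _ _ Dw) (tau_le1 _ _ _ Dw) (tau_01 _ _ _ Dw)).
have [c1 c10 Hc1] := per _ _ gE1 _ Dw1; have [c2 c20 Hc2] := per _ _ gE2 _ Dw2.
pose P1 k := k.+2%:R * tau w1 k; pose P2 k := k.+2%:R * tau w2 k.
have P12 k : P1 k * P2 k <= (2 * k.+2%:R / ct R k.+2 0) ^+ 2.
  have [mu1 A1 _ _] := Dw1 k; have [mu2 A2 _ _] := Dw2 k.
  have c0 := ct0_gt0 R (isT : 0 < k.+2)%N (isT : 1 < k.+2)%N.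
  have H : ct R k.+2 0 ^+ 2 <= (w1 k).1 * (w2 k).1.
    apply: (act_duality (isT : 1 < k.+2)%N gE1 n_gt0 _ _ (ltW mu1) (ltW mu2) A1 A2) => x.
      by rewrite (dnorm_ge0 gE1 n_gt0) (dnorm_field gE1 n_gt0).
    rewrite (dnorm_ge0 gE2 n_gt0) /=; apply: (dnorm_le gE2 n_gt0) => [|y].
      exact: snorm_ge0 gE1 _.
    exact: polar.
  have -> : P1 k * P2 k = (2 * k.+2%:R) ^+ 2 / ((w1 k).1 * (w2 k).1).
    by rewrite /P1 /P2 /tau; field; rewrite !gt_eqF.
  rewrite expr_div_n ler_pM2l ?exprn_gt0 ?mulr_gt0 //.
  by rewrite lef_pV2 // posrE ?(mulr_gt0 mu1 mu2) ?(exprn_gt0 _ c0).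
(* One ultrafilter finer than the filter at infinity serves both families, so the bound on the
   products passes to the limits. *)
have [U [UU sU]] := @ultraFilterLemma nat \oo eventually_filter.
have UP : ProperFilter U by exact: ultra_proper.
have cvgU (f : nat -> R) L : f k @[k --> \oo] --> L -> f k @[k --> U] --> L.
  by move=> fL A /fL /sU.
have sq : (2 * k.+2%:R / ct R k.+2 0) ^+ 2 @[k --> U] --> (pi ^+ 2 : R).
  apply: cvgU; rewrite expr2.
  have -> : (fun k => (2 * k.+2%:R / ct R k.+2 0) ^+ 2) =
      (fun k => (2 * k.+2%:R / ct R k.+2 0) * (2 * k.+2%:R / ct R k.+2 0)).
    by apply: funext => k; rewrite expr2.
  exact: (cvgM (@cvg_cot_pi R) (@cvg_cot_pi R)).
have bnd : \forall k \near U, (2 * k.+2%:R / ct R k.+2 0) ^+ 2 <= pi ^+ 2 + 1.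
  move/cvgrPdist_lt : (sq) => /(_ 1 ltr01); apply: filterS => k.
  by rewrite distrC => /(le_lt_trans (ler_norm _)); lra.
have P1c k : 0 < P1 k by rewrite (lt_le_trans c10 (Hc1 k)).
have P2c k : 0 < P2 k by rewrite (lt_le_trans c20 (Hc2 k)).
(* Each half-period is bounded above because the product is, while the other one stays away from
   0. *)
have [L1 HL1] : exists P : R, P1 k @[k --> U] --> P.
  apply: (@ultra_cvg_bounded R U P1 ((pi ^+ 2 + 1) / c2)) => //.
  apply: filterS bnd => k Hk; rewrite ltW //= ler_pdivlMr //.
  by rewrite (le_trans _ Hk) // (le_trans _ (P12 k)) // ler_pM2l //; exact: Hc2.
have [L2 HL2] : exists P : R, P2 k @[k --> U] --> P.
  apply: (@ultra_cvg_bounded R U P2 ((pi ^+ 2 + 1) / c1)) => //.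
  apply: filterS bnd => k Hk; rewrite ltW //= ler_pdivlMr //.
  by rewrite mulrC (le_trans _ Hk) // (le_trans _ (P12 k)) // ler_pM2r //; exact: Hc1.
have L10 : 0 < L1.
  rewrite (lt_le_trans c10) //; apply: (ler_cvg_to (cvg_cst c1) HL1); exact: nearW.
have L20 : 0 < L2.
  rewrite (lt_le_trans c20) //; apply: (ler_cvg_to (cvg_cst c2) HL2); exact: nearW.
have L12 : L1 * L2 <= pi ^+ 2.
  by apply: (ler_cvg_to (cvgM HL1 HL2) sq); exact: nearW.
have [gam1 [gc1 gcl1 g11 gd1]] := lim_action _ _ gE1 _ _ _ Dw1 UU sU HL1.
have [gam2 [gc2 gcl2 g21 gd2]] := lim_action _ _ gE2 _ _ _ Dw2 UU sU HL2.
have cc1 := closed_characteristic_of_orbit tot1 L10 gc1 gcl1 g11 gd1.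
have cc2 := closed_characteristic_of_orbit tot2 L20 gc2 gcl2 g21 gd2.
have /andP[a10 a1L] := min_action_le tot1 L10 cc1.
have /andP[a20 a2L] := min_action_le tot2 L20 cc2.
split; [exact: a10 | exact: a20 |].
exact: le_trans (ler_pM a10 a20 a1L a2L) L12.
Qed.

(** * Approximation by polytopes *)

Section ConvexBodies.
Variables (R : realType) (m : nat).
Local Notation V := 'rV[R]_m.
Implicit Types X : set V.

Lemma norm_le_entries (x : V) (M : R) :
  0 <= M -> (forall i, `|x 0 i| <= M) -> `|x| <= M.
Proof.
move=> M0 xM; rewrite -[`|x|]/(mx_norm x) mx_normrE; apply/bigmax_leP; split => //.
by move=> [i j] _ /=; rewrite ord1 xM.
Qed.

Lemma dot_le_norm (x y : V) : `|dot x y| <= m%:R * (`|x| * `|y|).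
Proof.
rewrite (le_trans (ler_norm_sum _ _ _)) //.
have -> : m%:R * (`|x| * `|y|) = \sum_(i < m) `|x| * `|y|.
  by rewrite sumr_const card_ord mulr_natl.
by apply: ler_sum => i _; rewrite normrM ler_pM // entry_le_norm.
Qed.

Lemma dot_expand (u v : V) (t : R) :
  dot (u - t *: v) (u - t *: v) = dot u u - 2 * t * dot u v + t ^+ 2 * dot v v.
Proof.
rewrite !(dotDl, dotDr, dotNl, dotNr, dotZl, dotZr) (dotC v u); ring.
Qed.

(* The separating functional points from the nearest point of [X] to [x0]. *)
Lemma separation X (x0 : V) : X !=set0 -> compact X ->
  (forall x y t, X x -> X y -> 0 <= t <= 1 -> X (t *: x + (1 - t) *: y)) ->
  ~ X x0 -> exists v b, (forall z, X z -> dot v z <= b) /\ b < dot v x0.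
Proof.
move=> Xn0 Xc cX nXx0.
have dc : continuous (fun z : V => dot (x0 - z) (x0 - z)).
  have c : continuous (fun z : V => x0 - z).
    apply: continuous_add; first exact: cst_continuous.
    by move=> z; exact: opp_continuous.
  exact: continuous_dot.
have [y] := compact_EVT_min Xn0 Xc (continuous_subspaceT dc).
rewrite inE => Xy ymin; set v := x0 - y.
have v0 : 0 < dot v v.
  apply: dot_gt0; rewrite subr_eq0; apply/eqP => x0y.
  by apply: nXx0; rewrite x0y.
exists v, (dot v y); split; last first.
  by rewrite -[x0](subrK y) dotDr -/v ltrDr.
move=> z Xz; rewrite -subr_ge0 -opprB oppr_ge0 -dotNr -dotDr.
set w := z - y; rewrite leNgt; apply/negP => vw.
have H t : 0 <= t <= 1 -> 2 * t * dot v w <= t ^+ 2 * dot w w.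
  move=> t01; have := ymin (t *: z + (1 - t) *: y); rewrite inE => /(_ (cX _ _ _ Xz Xy t01)).
  have -> : x0 - (t *: z + (1 - t) *: y) = v - t *: w.
    by rewrite /v /w; apply/rowP => i; rewrite !mxE; ring.
  rewrite dot_expand -/v; lra.
have w0 := dot_ge0 w.
have s0 : 0 < dot v w + dot w w by rewrite ltr_wpDr.
(* A step in [[0, 1]] with [t * dot w w <= dot v w], short enough for the linear gain to exceed the
   quadratic loss. *)
pose t := dot v w / (dot v w + dot w w).
have t0 : 0 < t by rewrite divr_gt0.
have t1 : t <= 1 by rewrite ler_pdivrMr // mul1r lerDl.
have := H t; rewrite (ltW t0) t1 => /(_ isT).
rewrite expr2 -mulrA [leLHS]mulrCA -[leRHS]mulrA ler_pM2l //.
have : t * dot w w <= dot v w.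
  by rewrite /t mulrAC ler_pdivrMr // ler_pM2l // lerDr ltW.
lra.
Qed.

Variable X : set V.
Hypotheses (bX : convex_body X) (sX : centrally_symmetric X).

Let cX : forall x y t, X x -> X y -> 0 <= t <= 1 -> X (t *: x + (1 - t) *: y).
Proof. by case: bX => _ /convex_setE. Qed.

Let NX x : X x -> X (- x).
Proof. by move=> Xx; rewrite sX; exists x. Qed.

Lemma body_bounded : exists2 C : R, 0 < C & forall x, X x -> `|x| <= C.
Proof.
case: bX => /compact_bounded/ex_strict_bound_gt0[C C0 XC] _ _.
by exists C => // x /XC /ltW.
Qed.

Lemma continuous_affine (a : V) (t : R) : continuous (fun u : V => t *: (u - a)).
Proof.
apply: continuous_scale; apply: continuous_add; last exact: cst_continuous.
by move=> z; exact: cvg_id.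
Qed.

(** Averaging a neighbourhood of an interior point [x0] with the point [- x0] fills a neighbourhood
    of the origin. *)
Lemma body_interior0 : interior X 0.
Proof.
case: bX => _ _ [x0 Xx0]; have X0 := interior_subset Xx0.
have : nbhs (0 : V) ((fun u => (2 : R) *: (u - - (2^-1 *: x0))) @^-1` X).
  apply: (@continuous_affine (- (2^-1 *: x0)) 2 0).
  by rewrite sub0r opprK scalerA divff // scale1r.
apply: filterS => u /=; rewrite opprK => Hu.
have := cX (t := 2^-1) Hu (NX X0) _.
have -> : 2^-1 *: ((2 : R) *: (u + 2^-1 *: x0)) + (1 - 2^-1) *: - x0 = u.
  by apply/rowP => i; rewrite !mxE; field.
by apply; rewrite invr_ge0 ler0n /= invf_le1 // ler1n.
Qed.

Let X0 : X 0. Proof. exact: interior_subset body_interior0. Qed.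

Lemma body_scale (t : R) x : 0 <= t <= 1 -> X x -> X (t *: x).
Proof. by move=> t01 Xx; have := cX Xx X0 t01; rewrite scaler0 addr0. Qed.

Lemma shrink_interior (t : R) x : 0 <= t < 1 -> X x -> interior X (t *: x).
Proof.
move=> /andP[t0 t1] Xx; have t1' : 0 < 1 - t by rewrite subr_gt0.
have : nbhs (t *: x) ((fun u => (1 - t)^-1 *: (u - t *: x)) @^-1` X).
  apply: continuous_affine; rewrite subrr scaler0; exact: body_interior0.
apply: filterS => u /= Hu.
have := cX (t := t) Xx Hu _; rewrite t0 ltW // => /(_ isT).
by rewrite scalerA divff ?gt_eqF // scale1r addrC subrK.
Qed.

(* Finitely many of the half-spaces separating [t X] from the points outside
   the interior of [X] suffice, by compactness. *)
Lemma polytope_approx (t : R) : 0 < t < 1 -> exists (N : nat) (l : 'I_N -> V),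
  [/\ forall x, (forall j, dot (l j) x = 0) -> x = 0,
      forall x, X x -> forall j, `|dot (l j) (t *: x)| <= 1
    & forall x, (forall j, `|dot (l j) x| <= 1) -> X x].
Proof.
move=> /andP[t0 t1]; have t01 : 0 <= t < 1 by rewrite ltW.
have t01' : 0 <= t <= 1 by rewrite !ltW.
have [C C0 XC] := body_bounded.
pose D := [set x : V | `|x| <= C] `&` ~` (interior X).
have Dc : compact D.
  apply: (@mx_bounded_closed_compact _ _ _ D C) => [x []//|].
  apply: closedI; last by rewrite closedC; exact: open_interior.
  apply: (@closed_comp _ _ (fun z : V => `|z|) [set r | r <= C]).
    by move=> z _; exact: norm_continuous.
  exact: closed_le.
pose I := [set w : V | forall x, X x -> `|dot w (t *: x)| <= 1].
pose f (w : V) := [set x : V | 1 < dot w x].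
have dlc (w : V) : continuous (dot w).
  by apply: continuous_dot => [|x]; [exact: cst_continuous | exact: cvg_id].
have fo w : I w -> open (f w).
  move=> _; apply: (@open_comp _ _ (dot w) [set r | 1 < r]); last exact: open_gt.
  by move=> z _; exact: dlc.
have Dcov : D `<=` cover I f.
  move=> x [_ nXx]; pose Y := [set t *: z | z in X].
  have Yc : compact Y.
    apply: continuous_compact; last by case: bX.
    apply: continuous_subspaceT; apply: continuous_scale.
    by move=> z; exact: cvg_id.
  have Yn0 : Y !=set0 by exists (t *: 0), 0.
  have cY y1 y2 s : Y y1 -> Y y2 -> 0 <= s <= 1 -> Y (s *: y1 + (1 - s) *: y2).
    move=> [z1 Xz1 <-] [z2 Xz2 <-] s01; exists (s *: z1 + (1 - s) *: z2).
      exact: cX.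
    by rewrite scalerDr !scalerA ![t * _]mulrC.
  have nYx : ~ Y x by move=> [z Xz zx]; apply: nXx; rewrite -zx; exact: shrink_interior.
  have [v [b [vb bx]]] := separation Yn0 Yc cY nYx.
  have b0 : 0 <= b by have := vb (t *: 0) (ex_intro2 _ _ 0 X0 erefl); rewrite scaler0 dot0r.
  (* Strictly between [b] and [dot v x], hence positive even when [b = 0], so that [v] can be
     normalized. *)
  pose c := (b + dot v x) / 2.
  have bc : b < c by rewrite /c; lra.
  have cx : c < dot v x by rewrite /c; lra.
  have c0 : 0 < c by exact: le_lt_trans bc.
  exists (c^-1 *: v) => /=.
    have le1 z : X z -> dot (c^-1 *: v) (t *: z) <= 1.
      move=> Xz; rewrite dotZl mulrC ler_pdivrMr // mul1r (le_trans _ (ltW bc)) //.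
      by apply: vb; exists z.
    move=> z Xz; rewrite ler_norml le1 // andbT lerNl -dotNr -scalerN.
    exact: le1 (NX Xz).
  by rewrite /f /= dotZl mulrC ltr_pdivlMr // mul1r.
move: Dc; rewrite compact_cover => /(_ _ I f fo Dcov)[D' D'I DD'].
(* The scaled coordinate functionals make the family total and confine its polytope to the norm ball
   of radius [C], so a point of the polytope outside [X] would lie in the covered set [D]. *)
pose s := [seq C^-1 *: (delta_mx 0 i : V) | i : 'I_m] ++ finmap.enum_fset D'.
have memd i : C^-1 *: (delta_mx 0 i : V) \in s.
  by rewrite mem_cat; apply/orP; left; apply/mapP; exists i; rewrite ?mem_enum.
have sE (P : V -> Prop) : (forall j : 'I_(size s), P (tnth (in_tuple s) j)) ->
    forall w, w \in s -> P w.
  by move=> H w ws; have /tnthP[j ->] : w \in in_tuple s by []; exact: H.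
exists (size s), (tnth (in_tuple s)); split.
- move=> x /(sE (fun w => dot w x = 0)) x0; apply/rowP => i; rewrite [RHS]mxE.
  have /x0 := memd i; rewrite dotZl dot_delta => /eqP; rewrite mulf_eq0 invr_eq0.
  by rewrite gt_eqF //= => /eqP.
- move=> x Xx j; have : tnth (in_tuple s) j \in s by exact: mem_tnth.
  rewrite mem_cat => /orP[/mapP[i _ ->]|/D'I]; last by rewrite inE; exact.
  rewrite dotZl dot_delta normrM gtr0_norm ?invr_gt0 // mulrC ler_pdivrMr // mul1r.
  rewrite (le_trans (entry_le_norm _ _ _)) // XC //; exact: body_scale.
- move=> x /(sE (fun w => `|dot w x| <= 1)) xs; apply: contrapT => nXx.
  have Dx : D x.
    split => /=; last by move=> /interior_subset.
    apply: norm_le_entries => [|i]; first exact: ltW.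
    have /xs := memd i; rewrite dotZl dot_delta normrM gtr0_norm ?invr_gt0 //.
    by rewrite mulrC ler_pdivrMr // mul1r.
  have [w wD'] := DD' x Dx; rewrite /f /= ltNge.
  have : w \in s by rewrite mem_cat orbC; move: wD' => /= ->.
  by move=> /xs /(le_trans (ler_norm _)) ->.
Qed.

End ConvexBodies.

(** * Polarity and capacities *)

(** One factor [t] pays for the polytope, the other for replacing the maximum of the [N] functionals
    by their power sum: [N * t ^ (2p + 2) <= 1] for large [p]. *)
Lemma pball_approx (R : realType) (n : nat) (X : set 'rV[R]_(n + n)) (t : R) :
  convex_body X -> centrally_symmetric X -> 0 < t < 1 ->
  exists (N p : nat) (l : 'I_N -> 'rV[R]_(n + n)),
  [/\ forall x, (forall j, dot (l j) x = 0) -> x = 0,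
      [set x | pnorm p l x <= 1] `<=` X
    & forall x, X x -> pnorm p l (t ^+ 2 *: x) <= 1].
Proof.
move=> bX sX t01; have [N [l [tot lX Xl]]] := polytope_approx bX sX t01.
have /andP[t0 t1] := t01.
have [p Np] : exists p : nat, N%:R * t ^+ (p.+1 * 2) <= 1.
  have : N%:R * t ^+ k @[k --> \oo] --> (N%:R * 0 : R).
    by apply: cvgM; [exact: cvg_cst | apply: cvg_expr; rewrite gtr0_norm].
  rewrite mulr0 => /cvgrPdist_lt/(_ 1 ltr01)[k _ Hk].
  exists k; have := Hk (k.+1 * 2)%N; rewrite /= sub0r normrN => H.
  by rewrite (le_trans (ler_norm _)) // ltW // H //; lia.
have pnorm_le1 x : (pnorm p l x <= 1) = (psum p l x <= 1).
  rewrite -pnormX -[in RHS](expr1n R (p.+1 * 2)) ler_pXn2r ?nnegrE ?pnorm_ge0 //.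
exists N, p, l; split => //.
- move=> x /=; rewrite pnorm_le1 => Fx; apply: Xl => j.
  have : dot (l j) x ^+ (p.+1 * 2) <= 1.
    apply: le_trans Fx; rewrite /psum (bigD1 j) //= lerDl sumr_ge0 // => i _.
    exact: even_powr_ge0.
  rewrite -[leLHS]ger0_norm ?even_powr_ge0 // normrX.
  by rewrite -[leRHS](expr1n R (p.+1 * 2)) ler_pXn2r ?nnegrE.
- move=> x Xx; rewrite pnorm_le1 expr2 -scalerA psumZ.
  rewrite (le_trans _ Np) // mulrC ler_pM2r ?exprn_gt0 //.
  rewrite (_ : N%:R = \sum_(j < N) 1); last by rewrite sumr_const card_ord.
  apply: ler_sum => j _; rewrite -[leLHS]ger0_norm ?even_powr_ge0 // normrX.
  by rewrite exprn_ile1 // lX.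
Qed.

Section Polar.
Variables (R : realType) (n : nat).
Local Notation V := 'rV[R]_(n + n).
Variable X : set V.
Hypotheses (bX : convex_body X) (sX : centrally_symmetric X).

Lemma norm_J_le (x : V) : `|J x| <= `|x|.
Proof.
apply: norm_le_entries => // i; rewrite /J mxE; case: splitP => j _;
  rewrite !mxE ?normrN; exact: entry_le_norm.
Qed.

Lemma polar_convex_body : convex_body (symplectic_polar X).
Proof.
have omc (x : V) : continuous (omega x).
  by apply: continuous_omega => [|y]; [exact: cst_continuous | exact: cvg_id].
have Pcl : closed (symplectic_polar X).
  have -> : symplectic_polar X = \bigcap_(x in X) [set y | omega x y <= 1].
    by apply/seteqP; split.
  apply: closed_bigI => x _.
  apply: (@closed_comp _ _ (omega x) [set r | r <= 1]); last exact: closed_le.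
  by move=> y _; exact: omc.
have [C C0 XC] := body_bounded bX.
split.
- have /nbhs_ballP[e /= e0 eX] := body_interior0 bX sX.
  apply: (@mx_bounded_closed_compact _ _ _ _ (2 / e)) => // y Py.
  apply: norm_le_entries => [|i]; first by rewrite divr_ge0 // ltW.
  (* Small multiples of [J] of the basis vectors lie in [X]; with [s = 1] and [s = -1] they bound
     each coordinate of a polar point from both sides. *)
  have Xd (s : R) : `|s| <= 1 -> X ((e / 2 * s) *: J (delta_mx 0 i)).
    move=> s1; apply: eX; rewrite -ball_normE /= sub0r normrN normrZ normrM.
    rewrite gtr0_norm ?divr_gt0 //.
    have d1 : `|delta_mx 0 i : V| <= 1.
      apply: norm_le_entries => // k; rewrite mxE eqxx /=.
      by case: eqP; rewrite ?normr1 ?normr0.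
    apply: (@le_lt_trans _ _ (e / 2)); last by rewrite ltr_pdivrMr // ltr_pMr // ltr1n.
    have Jd1 := le_trans (norm_J_le _) d1.
    rewrite -[leRHS]mulr1 ler_pM ?mulr_ge0 ?divr_ge0 ?(ltW e0) //.
    by rewrite -[leRHS]mulr1 ler_pM2l ?divr_gt0.
  have H s : `|s| <= 1 -> - (e / 2 * s) * y 0 i <= 1.
    by move=> /Xd/Py; rewrite omegaZl /omega JJ dotNl dot_delta mulrN mulNr.
  have e2 : 0 < e / 2 by rewrite divr_gt0.
  have := H (-1); rewrite normrN1 lexx => /(_ isT); rewrite mulrN1 opprK => H1.
  have := H 1; rewrite normr1 lexx => /(_ isT); rewrite mulr1 => H2.
  rewrite -invf_div -[leRHS]mulr1 -ler_pdivrMl ?invr_gt0 // invrK.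
  by rewrite -[e / 2]gtr0_norm // -normrM ler_norml H1 andbT; lra.
- apply/convex_setE => y z t Py Pz /andP[t0 t1] x Xx.
  rewrite omegaDr !omegaZr.
  have : t * omega x y <= t * 1 by rewrite ler_wpM2l // Py.
  have : (1 - t) * omega x z <= (1 - t) * 1 by rewrite ler_wpM2l ?subr_ge0 // Pz.
  lra.
- exists 0; apply/nbhs_ballP; exists ((n + n)%:R * C + 1)^-1.
    by rewrite /= invr_gt0 ltr_wpDl // mulr_ge0 // ltW.
  move=> y; rewrite -ball_normE /= sub0r normrN => yb x Xx.
  rewrite (le_trans (ler_norm _)) // (le_trans (dot_le_norm _ _)) //.
  have k0 : 0 < (n + n)%:R * C + 1 by rewrite ltr_wpDl // mulr_ge0 // ltW.
  apply: (@le_trans _ _ ((n + n)%:R * (C * `|y|))).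
    rewrite ler_wpM2l // ler_wpM2r // (le_trans (norm_J_le x)) // XC //.
  rewrite mulrA; have := ltW yb; rewrite -[X in _ <= X]mul1r ler_pdivlMr // => H.
  by have := normr_ge0 y; nra.
Qed.

Lemma polar_centrally_symmetric : centrally_symmetric (symplectic_polar X).
Proof.
have N y : symplectic_polar X y -> symplectic_polar X (- y).
  move=> Py x Xx; rewrite omegaNr -omegaNl; apply: Py.
  by rewrite sX; exists x.
apply/seteqP; split => [y Py|_ [y Py <-]]; last exact: N.
by exists (- y); [exact: N | rewrite opprK].
Qed.

End Polar.

(** Antisymmetry of [omega]: [omega x (- y) = omega y x], and [x] is itself a polar point. *)
Lemma self_polar_centrally_symmetric (R : realType) (n : nat)
    (X : set 'rV[R]_(n + n)) :
  symplectically_self_polar X -> centrally_symmetric X.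
Proof.
move=> [_ XE].
have N y : X y -> X (- y).
  move=> Xy; rewrite XE => x Xx; rewrite omegaNr -omegaC.
  by move: Xx; rewrite XE; exact.
apply/seteqP; split => [y Xy|_ [y Xy <-]]; last exact: N.
by exists (- y); [exact: N | rewrite opprK].
Qed.

Lemma pball_hausdorff (R : realType) (n : nat) (X : set 'rV[R]_(n + n)) (d : R) :
  convex_body X -> centrally_symmetric X -> 0 < d ->
  exists (N p : nat) (l : 'I_N -> 'rV[R]_(n + n)),
  [/\ forall x, (forall j, dot (l j) x = 0) -> x = 0,
      [set x | pnorm p l x <= 1] `<=` X
    & hausdorff_dist X [set x | pnorm p l x <= 1] < d].
Proof.
move=> bX sX d0; have [C C0 XC] := body_bounded bX.
pose M := Num.sqrt ((n + n)%:R * (C * C)) + 1.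
have M0 : 0 < M by rewrite ltr_wpDl // sqrtr_ge0.
have XM x : X x -> enorm x <= M.
  move=> Xx; rewrite (@le_trans _ _ (Num.sqrt ((n + n)%:R * (C * C)))) ?lerDl //.
  rewrite ler_sqrt ?mulr_ge0 ?(ltW C0) //.
  rewrite (le_trans (ler_norm _)) // (le_trans (dot_le_norm _ _)) //.
  by rewrite ler_wpM2l // ler_pM // XC.
(* Scaling by [(1 - r) ^ 2] moves points of [X] by at most [2 r M], which is at most [d / 2]. *)
pose r := Num.min (1 / 2) (d / (4 * M)).
have r0 : 0 < r by rewrite lt_min !divr_gt0 ?mulr_gt0.
have r1 : r <= 1 / 2 by rewrite /r ge_min lexx.
have rd : r <= d / (4 * M) by rewrite /r ge_min lexx orbT.
have t01 : 0 < 1 - r < 1 by lra.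
have [N [p [l [tot ZX XZ]]]] := pball_approx bX sX t01.
exists N, p, l; split => //.
have t2 : 0 <= 1 - (1 - r) ^+ 2 <= 2 * r by nra.
have t2M : (1 - (1 - r) ^+ 2) * M < d.
  move: rd; rewrite ler_pdivlMr ?mulr_gt0 // => rd.
  have /andP[_ t2'] := t2.
  have : (1 - (1 - r) ^+ 2) * M <= 2 * r * M by rewrite ler_pM2r.
  lra.
apply: le_lt_trans t2M; apply: ge_inf; first by exists 0 => e [].
have e0 : 0 <= (1 - (1 - r) ^+ 2) * M by rewrite mulr_ge0 ?(ltW M0) //; lra.
split => //.
- move=> x Xx; exists ((1 - r) ^+ 2 *: x); first exact: XZ.
  have -> : x - (1 - r) ^+ 2 *: x = (1 - (1 - r) ^+ 2) *: x.
    by rewrite scalerBl scale1r.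
  rewrite /enorm dotZl dotZr mulrA -expr2 sqrtrM ?sqr_ge0 // sqrtr_sqr.
  rewrite ger0_norm; last by lra.
  by rewrite ler_wpM2l ?XM //; lra.
- move=> y Zy; exists y; first exact: ZX.
  by rewrite subrr /enorm dot0l sqrtr0.
Qed.

(** A limit that does not exist has the default value 0, so a nonzero [c_EHZ X] is a true limit, and
    smooth power balls inside [X] occur in every Hausdorff neighbourhood. *)
Lemma c_EHZ_pball (R : realType) (n : nat) (X : set 'rV[R]_(n + n)) (e : R) :
  convex_body X -> centrally_symmetric X -> 0 < e -> c_EHZ X != 0 ->
  exists (N p : nat) (l : 'I_N -> 'rV[R]_(n + n)),
  [/\ forall x, (forall j, dot (l j) x = 0) -> x = 0,
      [set x | pnorm p l x <= 1] `<=` X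
    & `|c_EHZ X - min_action [set x | pnorm p l x <= 1]| < e].
Proof.
move=> bX sX e0 c0.
have cc : min_action Y @[Y --> within (@smooth_body R n) (hausdorff_nbhs X)] --> c_EHZ X.
  have [ex|nex] := pselect (exists l : R,
      min_action Y @[Y --> within (@smooth_body R n) (hausdorff_nbhs X)] --> l).
    exact: (xgetPex point ex).
  by move/eqP: c0; case; apply: xgetPN => l Hl; apply: nex; exists l.
have [d /= d0 Hd] : hausdorff_nbhs X [set Y | smooth_body Y -> ball (c_EHZ X) e (min_action Y)].
  exact: (cc _ (nbhsx_ballx (c_EHZ X) e e0)).
have [N [p [l [tot ZX Zd]]]] := pball_hausdorff bX sX d0.
exists N, p, l; split => //.
have := Hd _ Zd (pball_smooth_body p tot).
by rewrite -ball_normE.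
Qed.

Lemma c_EHZ_polar_le (R : realType) (n : nat) (X : set 'rV[R]_(n + n)) :
  convex_body X -> centrally_symmetric X ->
  c_EHZ X * c_EHZ (symplectic_polar X) <= pi ^+ 2.
Proof.
move=> bX sX; have bP := polar_convex_body bX sX.
have sP := polar_centrally_symmetric sX.
set c := c_EHZ X; set c' := c_EHZ _.
have [->|c0] := eqVneq c 0; first by rewrite mul0r sqr_ge0.
have [->|c'0] := eqVneq c' 0; first by rewrite mulr0 sqr_ge0.
have H e : 0 < e -> exists a a', [/\ `|c - a| < e, `|c' - a'| < e, 0 <= a, 0 <= a'
    & a * a' <= pi ^+ 2].
  move=> e0; have [N1 [p1 [l1 [tot1 Z1X Hc1]]]] := c_EHZ_pball bX sX e0 c0.
  have [N2 [p2 [l2 [tot2 Z2X Hc2]]]] := c_EHZ_pball bP sP e0 c'0.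
  have Z12 x y : [set x | pnorm p1 l1 x <= 1] x -> [set x | pnorm p2 l2 x <= 1] y ->
    omega x y <= 1 by move=> /Z1X Xx /Z2X; exact.
  have [a0 a0' aa] := pair_min_action tot1 tot2 Z12.
  by do 2 eexists; split; [exact: Hc1 | exact: Hc2 | exact: a0 | exact: a0' | exact: aa].
apply/ler_addgt0Pr => d d0.
(* With [e <= 1] one has [a' <= |c'| + 1], so [c c' - a a'] is at most [e * (|c| + |c'| + 1)]. *)
pose K := `|c| + `|c'| + 1; have K0 : 0 < K by rewrite ltr_wpDl // addr_ge0.
pose e := Num.min 1 (d / K).
have e0 : 0 < e by rewrite lt_min ltr01 divr_gt0.
have [a [a' [ca ca' a0 a0' aa]]] := H e e0.
have e1 : e <= 1 by rewrite /e ge_min lexx.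
have eK : e * K <= d by rewrite -ler_pdivlMr // /e ge_min lexx orbT.
have := ler_norm c; have := ler_norm c'; rewrite -/c'.
move: ca ca'; rewrite !ltr_norml => /andP[ca1 ca2] /andP[ca'1 ca'2] Hc' Hc.
have : c * c' - a * a' = c * (c' - a') + (c - a) * a' by ring.
move: (normr_ge0 c) (normr_ge0 c') eK; rewrite /K => nc nc' eK.
have h1 : c * (c' - a') <= `|c| * e.
  by rewrite (le_trans (ler_norm _)) // normrM ler_wpM2l // ler_norml; lra.
have h2 : (c - a) * a' <= e * (`|c'| + 1).
  have a'1 : a' <= `|c'| + 1 by lra.
  apply: (@le_trans _ _ (e * a')); first by rewrite ler_wpM2r // ltW.
  by rewrite ler_wpM2l // ltW.
nra.
Qed.

Theorem theorem5p3 (R : realType) (n : nat) :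
  (forall X : set 'rV[R]_(n + n),
     convex_body X -> centrally_symmetric X ->
     c_EHZ X * c_EHZ (symplectic_polar X) <= pi ^+ 2) /\
  (forall X : set 'rV[R]_(n + n),
     convex_body X -> symplectically_self_polar X -> c_EHZ X <= pi).
Proof.
split=> [X|X bX spX]; first exact: c_EHZ_polar_le.
have sX := self_polar_centrally_symmetric spX.
have := c_EHZ_polar_le bX sX; rewrite -(proj2 spX) -expr2 => H.
have p0 := pi_gt0 R; rewrite leNgt; apply/negP => pc.
by move: H; rewrite leNgt ltrXn2r ?ltW.
Qed.
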